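(* For every $n\ge 1$ and every partition $\lambda\subseteq\delta_n$, the polytope $\mathcal{P}_\lambda(n)$ is affinely equivalent to the order polytope $\mathcal{O}\big((\delta_n\setminus\lambda)^*\big)$ and to the flow polytope $\mathcal{F}_{G_{(\delta_n\setminus\lambda)^*}}$. In particular, every polytope in the family $\{\mathcal{P}_\lambda(n)\mid \lambda\subseteq\delta_n\}$ is affinely equivalent to both an order polytope and a flow polytope.
   Context: For $n\ge1$, the alternating sign matrix polytope $\mathcal{A}(n)$ is the set of real $n\times n$ matrices $(a_{ij})$ with $0\le\sum_{i=1}^{i'}a_{ij}\le1$ for all $1\le i',j\le n$, $0\le\sum_{j=1}^{j'}a_{ij}\le 1$ for all $1\le j',i\le n$, $\sum_{i=1}^n a_{ij}=1$ for all $j$ and $\sum_{j=1}^n a_{ij}=1$ for all $i$. Let $\delta_n=(n-1,n-2,\dots,1)$ be the staircase partition, identified with the set of matrix positions $\{(i,j):1\le i<j\le n\}$. A partition $\lambda=(\lambda_1,\dots,\lambda_k)\subseteq\delta_n$ (i.e. $\lambda_i\le n-i$) is identified with the set of positions $\{(i,j):1\le i\le k,\ n-\lambda_i+1\le j\le n\}\subseteq\delta_n$. Define $\mathcal{P}_\lambda(n)=\{(a_{ij})\in\mathcal{A}(n): a_{ij}=0 \text{ whenever } i-j\ge2 \text{ and whenever } (i,j)\in\lambda\}$. The poset $(\delta_n\setminus\lambda)^*$ has elements $p_{ij}$, $(i,j)\in\delta_n\setminus\lambda$, with $p_{ij}\le p_{i'j'}$ iff $i\ge i'$ and $j\le j'$;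 this poset is strongly planar (its Hasse diagram drawn naturally from the grid of matrix positions). Order polytope: for a finite poset $P$, $\mathcal{O}(P)=\{x\in[0,1]^P: x_s\le x_t \text{ whenever } s\le_P t\}$. Flow polytope: for a finite acyclic directed (multi)graph $G$ with a unique source $s$ and unique sink $t$, $\mathcal{F}_G$ is the set of $fl:E(G)\to\mathbb{R}_{\ge0}$ with total flow out of $s$ equal to $1$, total flow into $t$ equal to $1$, and inflow equal to outflow at every other vertex. The graph $G_P$: a poset $P$ is strongly planar if the Hasse diagram of $\widehat P=P\sqcup\{\hat0,\hat1\}$ has a planar embedding with all edges directed upward. Fix such an embedding, and form $\widehat G$ by adding to this Hasse diagram two edges from $\hat0$ to $\hat1$, one passing to the left of all poset elements and one to the right. $G_P$ is the truncated dual of $\widehat G$: its vertices are the bounded faces of $\widehat G$, and for each Hasse-diagram edge $x\to y$ ($x<y$) separating two bounded faces there is an edge of $G_P$ crossing it, oriented so that $y$ lies to its left and $x$ to its right as one traverses it (the face at the infinite region and its incident edges are deleted). The source of $G_P$ is the leftmost bounded face and the sink is the rightmost. Two polytopes are affinely equivalent if there is an affine map restricting to a bijection from one onto the other. *)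

(* Defs.v *)
From HB Require Import structures.
From mathcomp Require Import all_boot all_order all_algebra.
From mathcomp Require Import zify ring lra.

Set Implicit Arguments.
Unset Strict Implicit.
Unset Printing Implicit Defensive.

Import Order.TTheory GRing.Theory Num.Theory.

Local Open Scope ring_scope.

Definition affine_equiv (R : realFieldType) (V W : lmodType R)
    (A : V -> Prop) (B : W -> Prop) : Prop :=
  exists (L : {linear V -> W}) (b : W),
    [/\ forall x, A x -> B (L x + b),
        forall x y, A x -> A y -> L x + b = L y + b -> x = y
      & forall y, B y -> exists2 x, A x & L x + b = y].

(* Rows and columns are indexed from 0: the entry in position (i, j) of the
   usual numbering is [A (i-1) (j-1)]. *)
Definition asm_polytope (R : realFieldType) (n : nat) (A : 'M[R]_n) : Prop :=
  [/\ forall i' j, 0 <= \sum_(i < n | (i <= i')%N) A i j <= 1,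
      forall i j', 0 <= \sum_(j < n | (j <= j')%N) A i j <= 1,
      forall j, \sum_(i < n) A i j = 1
    & forall i, \sum_(j < n) A i j = 1].

(* Partitions contained in the staircase (n-1, n-2, ..., 1). *)
Record stair_partition (n : nat) := StairPartition {
  parts :> seq nat;
  parts_sorted : sorted geq parts;
  parts_gt0 : all (ltn 0) parts;
  parts_stair : forall i, (i < size parts)%N -> (nth 0 parts i <= n - i.+1)%N
}.

Definition in_diagram (n : nat) (lam : stair_partition n) (i j : nat) : bool :=
  (i < size lam)%N && (n - nth 0%N lam i <= j)%N.

Definition asm_face (R : realFieldType) (n : nat) (lam : stair_partition n)
    (A : 'M[R]_n) : Prop :=
  [/\ asm_polytope A,
      forall i j : 'I_n, (j.+2 <= i)%N -> A i j = 0
    & forall i j : 'I_n, in_diagram lam i j -> A i j = 0].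
Arguments asm_face R {n} lam A.

Definition skew_cell (n : nat) (lam : stair_partition n) :=
  {c : 'I_n * 'I_n | (c.1 < c.2)%N && ~~ in_diagram lam c.1 c.2}.

HB.instance Definition _ (n : nat) (lam : stair_partition n) :=
  Finite.copy (skew_cell lam)
    {c : 'I_n * 'I_n | (c.1 < c.2)%N && ~~ in_diagram lam c.1 c.2}.

Section SkewPoset.
Context (n : nat) (lam : stair_partition n).
Implicit Types p q : skew_cell lam.

Definition cell_row p : nat := (val p).1.
Definition cell_col p : nat := (val p).2.

Definition skew_le p q : bool := (cell_row q <= cell_row p)%N && (cell_col p <= cell_col q)%N.

Fact skew_le_refl : reflexive skew_le.
Proof. by move=> p; rewrite /skew_le !leqnn. Qed.

Lemma skew_cell_inj p q : cell_row p = cell_row q -> cell_col p = cell_col q -> p = q.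
Proof.
move=> er ec; apply: val_inj; rewrite [LHS]surjective_pairing.
by rewrite [RHS]surjective_pairing; congr (_, _); apply: val_inj.
Qed.

Fact skew_le_anti : antisymmetric skew_le.
Proof.
move=> p q /andP[/andP[a b] /andP[c d]].
by apply: skew_cell_inj; apply/eqP; rewrite eqn_leq ?a ?b ?c ?d.
Qed.

Fact skew_le_trans : transitive skew_le.
Proof.
move=> q p r /andP[a b] /andP[c d].
by rewrite /skew_le (leq_trans c a) (leq_trans b d).
Qed.

HB.instance Definition _ := Order.Le_isPOrder.Build (Order.Disp tt tt)
  (skew_cell lam) skew_le_refl skew_le_anti skew_le_trans.
End SkewPoset.

Definition order_polytope (R : realFieldType) (d : Order.disp_t)
    (P : finPOrderType d) (x : {ffun P -> R^o}) : Prop :=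
  (forall p, (0 : R) <= x p <= 1)
  /\ (forall p q, (p <= q)%O -> (x p : R) <= x q).
Arguments order_polytope R {d} P x.

Record network := Network {
  vertex : finType;
  edge : finType;
  edge_tail : edge -> vertex;
  edge_head : edge -> vertex;
  source : vertex;
  sink : vertex
}.

Definition adjacent (G : network) : rel (vertex G) :=
  [rel u v | [exists e : edge G, (edge_tail e == u) && (edge_head e == v)]].

(* Acyclic, with [source] as only source and [sink] as only sink. *)
Definition flow_network (G : network) : Prop :=
  [/\ forall u v, adjacent u v -> ~~ connect (@adjacent G) v u,
      forall v : vertex G, (forall e : edge G, edge_head e != v) <-> v = source G
    & forall v : vertex G, (forall e : edge G, edge_tail e != v) <-> v = sink G].

Definition flow_polytope (R : realFieldType) (G : network)
    (fl : {ffun edge G -> R^o}) : Prop :=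
  [/\ forall e, (0 : R) <= fl e,
      \sum_(e | edge_tail e == source G) (fl e : R) = 1,
      \sum_(e | edge_head e == sink G) (fl e : R) = 1
    & forall v, v != source G -> v != sink G ->
        \sum_(e | edge_head e == v) (fl e : R)
        = \sum_(e | edge_tail e == v) (fl e : R)].
Arguments flow_polytope R G fl : clear implicits.

Section TruncatedDual.
Context (d : Order.disp_t) (P : finPOrderType d).

(* P with a new least element [hat0] and a new greatest element [hat1]. *)
Definition hat : finType := (P + bool)%type.

Definition hat0 : hat := inr false.
Definition hat1 : hat := inr true.

Definition hat_lt (x y : hat) : bool :=
  match x, y with
  | inl p, inl q => (p < q)%O
  | inl _, inr b => b
  | inr b, inl _ => ~~ b
  | inr b, inr b' => ~~ b && b'
  end.

Definition hasse (x y : hat) : bool :=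
  hat_lt x y && ~~ [exists z, hat_lt x z && hat_lt z y].

Definition hasse_edge : finType := {e : hat * hat | hasse e.1 e.2}.

Definition lower (e : hasse_edge) : hat := (val e).1.
Definition upper (e : hasse_edge) : hat := (val e).2.

(* The edges of the Hasse diagram are drawn as straight line segments. *)
Definition segment_point (R : realFieldType) (pos : hat -> R * R)
    (e : hasse_edge) (t : R) : R * R :=
  ((1 - t) * (pos (lower e)).1 + t * (pos (upper e)).1,
   (1 - t) * (pos (lower e)).2 + t * (pos (upper e)).2).

Record upward_embedding (R : realFieldType) := UpwardEmbedding {
  pos :> hat -> R * R;
  pos_inj : injective pos;
  pos_upward : forall e, (pos (lower e)).2 < (pos (upper e)).2;
  pos_vertex : forall v e (t : R), 0 <= t <= 1 ->
    segment_point pos e t = pos v -> v = lower e \/ v = upper e;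
  pos_planar : forall e e' (t t' : R), 0 <= t <= 1 -> 0 <= t' <= 1 -> e <> e' ->
    segment_point pos e t = segment_point pos e' t' ->
    exists2 v, segment_point pos e t = pos v
             & (v = lower e \/ v = upper e) /\ (v = lower e' \/ v = upper e')
}.

Context (R : realFieldType) (D : upward_embedding R).

(* [inr false] and [inr true] are the additional edges from [hat0] to [hat1],
   to the left and to the right of the Hasse diagram respectively. *)
Definition hat_edge : finType := (hasse_edge + bool)%type.

(* Rate of change of the abscissa when going up along an edge: the edges going
   up from a vertex are ordered from left to right by increasing [drift], those
   going down from it by decreasing [drift]. *)
Definition drift (e : hasse_edge) : R :=
  ((D (upper e)).1 - (D (lower e)).1) / ((D (upper e)).2 - (D (lower e)).2).

Definition enframe (b : bool) (s : seq hasse_edge) : seq hat_edge :=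
  let s' := [seq inl e | e <- s] in
  if b then inr false :: rcons s' (inr true) else s'.

Definition up_edges (v : hat) : seq hat_edge :=
  enframe (v == hat0)
    (sort (fun e e' => drift e <= drift e')
       [seq e <- enum {: hasse_edge} | lower e == v]).

Definition down_edges (v : hat) : seq hat_edge :=
  enframe (v == hat1)
    (sort (fun e e' => drift e' <= drift e)
       [seq e <- enum {: hasse_edge} | upper e == v]).

(* The dart [(e, true)] is the edge e traversed upward, [(e, false)] is e
   traversed downward. *)
Definition dart : finType := (hat_edge * bool)%type.

Definition dart_end (x : dart) : hat :=
  match x.1 with
  | inl e => if x.2 then upper e else lower e
  | inr _ => if x.2 then hat1 else hat0
  end.

(* The darts leaving v, in clockwise order. *)
Definition clockwise (v : hat) : seq dart :=
  [seq (e, true) | e <- up_edges v] ++ rev [seq (e, false) | e <- down_edges v].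

(* Traces the boundary of the face lying to the left of a dart. *)
Definition face_step (x : dart) : dart :=
  next (clockwise (dart_end x)) (x.1, ~~ x.2).

(* The face to the left of a dart, given by the darts along its boundary; the
   graph being connected, every face has a single boundary walk. *)
Definition face_of (x : dart) : {set dart} :=
  [set y | fconnect face_step x y].

(* The unbounded region lies to the left of the leftmost edge going up. *)
Definition unbounded_face : {set dart} := face_of (inr false, true).

Definition bounded_face (f : {set dart}) : bool :=
  (f \in [set face_of x | x : dart]) && (f != unbounded_face).

Definition left_face (e : hat_edge) : {set dart} := face_of (e, true).
Definition right_face (e : hat_edge) : {set dart} := face_of (e, false).

Definition dual_vertex : finType := {f : {set dart} | bounded_face f}.

Definition dual_edge : finType :=
  {e : hasse_edge | [&& bounded_face (left_face (inl e)),
     bounded_face (right_face (inl e)) & left_face (inl e) != right_face (inl e)]}.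

Fact dual_tail_subproof (e : dual_edge) : bounded_face (left_face (inl (val e))).
Proof. by have /and3P[] := valP e. Qed.
Fact dual_head_subproof (e : dual_edge) : bounded_face (right_face (inl (val e))).
Proof. by have /and3P[] := valP e. Qed.

(* Crossing e with its upper end on the left means crossing it rightward. *)
Definition dual_tail (e : dual_edge) : dual_vertex :=
  exist _ (left_face (inl (val e))) (dual_tail_subproof e).
Definition dual_head (e : dual_edge) : dual_vertex :=
  exist _ (right_face (inl (val e))) (dual_head_subproof e).

Lemma next_frame (T : eqType) (x y : T) s :
  y \notin x :: s -> next (x :: rcons s y) y = x.
Proof.
rewrite /= inE negb_or => /andP[].
suff H z : y != z -> y \notin s -> next_at y x z (rcons s y) = x by exact: H.
elim: s z => [|a s IH] z nyz; rewrite /= (negbTE nyz) ?eqxx //.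
by rewrite inE negb_or => /andP[nya nys]; apply: IH.
Qed.

Lemma up_edges_hat1 : up_edges hat1 = [::].
Proof.
rewrite /up_edges (_ : [seq e <- _ | _] = [::]) //.
apply/eqP; rewrite -[_ == _]negbK -has_filter; apply/hasPn => e _.
by apply/eqP => h; case: e h => -[x y] /= H; rewrite /lower /= => h; move: H; rewrite h; case: y.
Qed.

Lemma down_edges_hat0 : down_edges hat0 = [::].
Proof.
rewrite /down_edges (_ : [seq e <- _ | _] = [::]) //.
apply/eqP; rewrite -[_ == _]negbK -has_filter; apply/hasPn => e _.
apply/eqP => h; case: e h => -[x y] /= H; rewrite /upper /= => h.
by move: H; rewrite h /hasse; case: x => [p|[]].
Qed.

Lemma face_step_left : face_step (inr false, true) = (inr true, false).
Proof.
rewrite /face_step /clockwise [dart_end _]/= up_edges_hat1 /down_edges.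
rewrite /enframe eqxx cat0s map_cons map_rcons rev_cons rev_rcons.
apply: next_frame.
rewrite inE /= mem_rev; apply/mapP => -[e es [eE]]; move: es.
by rewrite -eE => /mapP[].
Qed.

Lemma face_step_right : face_step (inr true, false) = (inr false, true).
Proof.
rewrite /face_step /clockwise [dart_end _]/= down_edges_hat0 /up_edges.
rewrite /enframe eqxx cats0 map_cons map_rcons.
apply: next_frame.
rewrite inE /=; apply/mapP => -[e es [eE]]; move: es.
by rewrite -eE => /mapP[].
Qed.

Lemma unbounded_faceE :
  unbounded_face = [set (inr false, true); (inr true, false)].
Proof.
apply/setP => y; rewrite !inE; apply/idP/idP.
  case/connectP => s; elim: s (inr false, true)
     (inr true, false) face_step_left face_step_right => [|z s IH] a b ab ba.
    by move=> _ ->; rewrite eqxx.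
  move=> /=; case/andP => /eqP; rewrite ab => <- sb ys.
  by rewrite orbC; apply: IH ba ab sb ys.
case/orP => /eqP ->; first exact: connect0.
by apply: connect1; rewrite /= face_step_left.
Qed.

Fact leftmost_face_bounded : bounded_face (right_face (inr false)).
Proof.
rewrite /bounded_face /right_face imset_f //=; apply/eqP => E.
have : (inr false, false) \in face_of (inr false, false) by rewrite inE connect0.
by rewrite E unbounded_faceE !inE.
Qed.

Fact rightmost_face_bounded : bounded_face (left_face (inr true)).
Proof.
rewrite /bounded_face /left_face imset_f //=; apply/eqP => E.
have : (inr true, true) \in face_of (inr true, true) by rewrite inE connect0.
by rewrite E unbounded_faceE !inE.
Qed.

Definition truncated_dual : network := {|
  edge_tail := dual_tail;
  edge_head := dual_head;
  source := exist _ (right_face (inr false)) leftmost_face_bounded;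
  sink := exist _ (left_face (inr true)) rightmost_face_bounded
|}.

End TruncatedDual.

Section GridEmbedding.
Context (R : realFieldType) (n : nat) (lam : stair_partition n).
Let P := skew_cell lam.

(* The matrix turned by 45 degrees, so that north-east becomes up. *)
Definition grid_pos (v : hat P) : R * R :=
  match v with
  | inl p => ((cell_row p + cell_col p)%:R, (cell_col p)%:R - (cell_row p)%:R)
  | inr b => (n%:R, if b then (2 * n + 1)%:R else 0)
  end.

Lemma in_diagram_mono i j i' j' : (i' <= i)%N -> (j <= j')%N ->
  in_diagram lam i j -> in_diagram lam i' j'.
Proof.
move=> ii jj /andP[isz nj]; rewrite /in_diagram (leq_ltn_trans ii isz) /=.
suff : (nth 0 lam i <= nth 0 lam i')%N by lia.
have := parts_sorted lam => /(sorted_leq_nth (rev_trans leq_trans) leqnn 0%N).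
by apply; rewrite ?inE // (leq_ltn_trans ii isz).
Qed.

Lemma cell_bounds (p : P) : (cell_row p < cell_col p < n)%N.
Proof.
by case: p => -[i j] /= H; have /andP[h _] := H; rewrite h /=; apply: ltn_ord.
Qed.

Lemma cell_notin (p : P) : ~~ in_diagram lam (cell_row p) (cell_col p).
Proof. by case: p => -[i j] /= H; have /andP[] := H. Qed.

Lemma cell_ex (p : P) i j : (i < j)%N -> (cell_row p <= i)%N ->
  (j <= cell_col p)%N -> exists q : P, cell_row q = i /\ cell_col q = j.
Proof.
move=> ij pi jp; have /andP[_ pn] := cell_bounds p.
have jn := leq_ltn_trans jp pn; have iN := ltn_trans ij jn.
have H : (Ordinal iN < Ordinal jn)%N && ~~ in_diagram lam (Ordinal iN) (Ordinal jn).
  by rewrite ij /=; apply: contra (cell_notin p); apply: in_diagram_mono.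
by exists (exist _ (Ordinal iN, Ordinal jn) H).
Qed.

Lemma cell_ltP (p q : P) : reflect
  [/\ (cell_row q <= cell_row p)%N, (cell_col p <= cell_col q)%N
    & (cell_row q < cell_row p)%N \/ (cell_col p < cell_col q)%N] (p < q)%O.
Proof.
rewrite lt_neqAle; apply: (iffP andP) => [[/eqP npq /andP[a b]]|[a b c]].
  split=> //; case: (ltnP (cell_row q) (cell_row p)) => [|h1]; first by left.
  right; rewrite ltnNge; apply/negP => h2; apply: npq.
  by apply: skew_cell_inj; lia.
split; last by apply/andP.
by apply/eqP => E; subst q; lia.
Qed.

Variant grid_edge_spec : hat P -> hat P -> Prop :=
  | GridBottom p of (cell_col p = (cell_row p).+1)%N :
      grid_edge_spec (hat0 P) (inl p)
  | GridRight p q of cell_row q = cell_row p & cell_col q = (cell_col p).+1 :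
      grid_edge_spec (inl p) (inl q)
  | GridUp p q of cell_row p = (cell_row q).+1 & cell_col q = cell_col p :
      grid_edge_spec (inl p) (inl q)
  | GridTop p of (forall q : P, ~~ (p < q)%O) :
      grid_edge_spec (inl p) (hat1 P)
  | GridEmpty of (P -> False) : grid_edge_spec (hat0 P) (hat1 P).

Lemma grid_edgeP x y : hasse x y -> grid_edge_spec x y.
Proof.
case/andP=> xy /existsPn nz; case: x y xy nz => [p|[]] [q|[]] //=.
- case/cell_ltP => a b c nz; have /andP[hp _] := cell_bounds p.
  case: (ltnP (cell_row q) (cell_row p)) => [h|h].
    have [||| r [ri rj]] := @cell_ex q (cell_row p).-1 (cell_col p); try lia.
    have pr : (p < r)%O by apply/cell_ltP; split; [lia|lia|left; lia].
    have /= := nz (inl r); rewrite pr /= => nrq.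
    have erq : r = q.
      apply/eqP; apply: contraNT nrq => nrq; rewrite lt_neqAle nrq /=.
      by apply/andP; rewrite ri rj; split; lia.
    by apply: GridUp; subst r; lia.
  have [||| r [ri rj]] := @cell_ex q (cell_row p) (cell_col p).+1; try lia.
  have pr : (p < r)%O by apply/cell_ltP; split; [lia|lia|right; lia].
  have /= := nz (inl r); rewrite pr /= => nrq.
  have erq : r = q.
    apply/eqP; apply: contraNT nrq => nrq; rewrite lt_neqAle nrq /=.
    by apply/andP; rewrite ri rj; split; lia.
  by apply: GridRight; subst r; lia.
- by move=> _ nz; apply: GridTop => q; have := nz (inl q); rewrite /= andbT.
- move=> _ nz; apply: GridBottom; have /andP[hq _] := cell_bounds q.
  case: (ltnP (cell_row q).+1 (cell_col q)) => h; last lia.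
  have [||| r [ri rj]] := @cell_ex q (cell_row q) (cell_row q).+1; try lia.
  have /= := nz (inl r); suff -> : (r < q)%O by [].
  by apply/cell_ltP; split; [lia|lia|right; lia].
- by move=> _ nz; apply: GridEmpty => p; have := nz (inl p).
Qed.

Let segment (x y : hat P) (t : R) : R * R :=
  ((1 - t) * (grid_pos x).1 + t * (grid_pos y).1,
   (1 - t) * (grid_pos x).2 + t * (grid_pos y).2).

Let posE (p : P) : grid_pos (inl p) =
  ((cell_row p)%:R + (cell_col p)%:R, (cell_col p)%:R - (cell_row p)%:R).
Proof. by rewrite /= natrD. Qed.

Let pos0E : grid_pos (hat0 P) = (n%:R, 0).
Proof. by []. Qed.

Let pos1E : grid_pos (hat1 P) = (n%:R, 2 * n%:R + 1).
Proof. by rewrite /= natrD natrM. Qed.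

Let cell_boundsR (p : P) :
  [/\ 0 <= (cell_row p)%:R :> R, (cell_row p)%:R + 1 <= (cell_col p)%:R :> R
    & (cell_col p)%:R + 1 <= n%:R :> R].
Proof.
have /andP[a b] := cell_bounds p.
by split; rewrite ?ler0n // natr1 ler_nat.
Qed.

Let n_ge0 : 0 <= n%:R :> R. Proof. by rewrite ler0n. Qed.

Lemma grid_pos_inj : injective grid_pos.
Proof.
have H p b : grid_pos (inl p) <> grid_pos (inr b).
  rewrite posE; case: (cell_boundsR p) => a1 a2 a3.
  by case: b; rewrite ?pos1E ?pos0E => -[_ ?]; lra.
case=> [p|b] [q|b'].
- rewrite !posE => -[e1 e2]; congr inl.
  by apply: skew_cell_inj; apply/eqP; rewrite -(eqr_nat R); apply/eqP; lra.
- by move/H.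
- by move/esym/H.
by case: b b' => -[] // -[/eqP]; rewrite ?[0 == _]eq_sym pnatr_eq0 addn1.
Qed.

Let segment0 x y : segment x y 0 = grid_pos x.
Proof. by rewrite /segment subr0 !mul1r !mul0r !addr0; case: (grid_pos x). Qed.

Let segment1 x y : segment x y 1 = grid_pos y.
Proof. by rewrite /segment subrr !mul1r !mul0r !add0r; case: (grid_pos y). Qed.

Let nat01 (i j : nat) (t : R) : 0 <= t <= 1 -> i%:R + t = j%:R -> t = 0 \/ t = 1.
Proof.
move=> /andP[t0 t1] e.
have : (i <= j <= i.+1)%N.
  by rewrite -!(ler_nat R) -natr1; apply/andP; split; lra.
case/andP; rewrite leq_eqVlt => /orP[/eqP ij _|ij ji].
  by left; rewrite ij in e; lra.
have ij' : j = i.+1 by lia.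
by right; rewrite ij' -natr1 in e; lra.
Qed.

Let cell_lt_maxF (p q : P) : (forall q : P, ~~ (p < q)%O) ->
  (cell_row q <= cell_row p)%N -> (cell_col p <= cell_col q)%N ->
  (cell_row q < cell_row p)%N \/ (cell_col p < cell_col q)%N -> False.
Proof. by move=> m a b c; have /negP := m q; apply; apply/cell_ltP. Qed.

Let n1 : 2 * n%:R + 1 != 0 :> R.
Proof. by apply: lt0r_neq0; have := n_ge0; lra. Qed.

Lemma grid_vertex (v x y : hat P) (t : R) : hasse x y -> 0 <= t <= 1 ->
  segment x y t = grid_pos v -> v = x \/ v = y.
Proof.
move=> xy t01 e.
suff [t0|t1] : t = 0 \/ t = 1.
- by left; apply: grid_pos_inj; rewrite -e t0 segment0.
- by right; apply: grid_pos_inj; rewrite -e t1 segment1.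
have /andP[tg tl] := t01.
case: (grid_edgeP xy) e => [p hp|p q hr hc|p q hr hc|p pmax|nP].
- have [a1 a2 a3] := cell_boundsR p.
  rewrite /segment posE pos0E hp -natr1 /=.
  case: v => [q|[]]; rewrite ?posE ?pos0E ?pos1E /= => -[e1 e2].
  + by have [b1 b2 b3] := cell_boundsR q; right; lra.
  + by exfalso; lra.
  + by left; lra.
- have [a1 a2 a3] := cell_boundsR p; have [c1 c2 c3] := cell_boundsR q.
  move: c1 c2 c3; rewrite /segment !posE hr hc -natr1 /= => c1 c2 c3.
  case: v => [r|[]]; rewrite ?posE ?pos0E ?pos1E /= => -[e1 e2].
  + by apply: (@nat01 (cell_col p) (cell_col r)); lra.
  + by exfalso; lra.
  + by exfalso; lra.
- have [a1 a2 a3] := cell_boundsR p; have [c1 c2 c3] := cell_boundsR q.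
  move: a1 a2 a3; rewrite /segment !posE hr hc -natr1 /= => a1 a2 a3.
  case: v => [r|[]]; rewrite ?posE ?pos0E ?pos1E /= => -[e1 e2].
  + apply: (@nat01 (cell_row r) (cell_row q).+1) => //; rewrite -natr1; lra.
  + by exfalso; lra.
  + by exfalso; lra.
- have [a1 a2 a3] := cell_boundsR p.
  rewrite /segment !posE pos1E /=.
  case: v => [r|[]]; rewrite ?posE ?pos0E ?pos1E /= => -[e1 e2].
  + left; apply/eqP; case: eqVneq => // tn0; exfalso.
    have tp : 0 < t by rewrite lt_neqAle eq_sym tn0.
    have h1 : (cell_row r < cell_row p)%N by rewrite -(ltr_nat R); nra.
    have h2 : (cell_col p < cell_col r)%N by rewrite -(ltr_nat R); nra.
    by apply: (cell_lt_maxF pmax (ltnW h1) (ltnW h2)); left.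
  + by right; nra.
  + by exfalso; nra.
rewrite /segment pos0E pos1E; case: v => [r|[]]; first by case: (nP r).
  by rewrite pos1E /= => -[_ e2]; right; clear nP; apply: (mulIf n1); lra.
by rewrite pos0E /= => -[_ e2]; left; clear nP; apply: (mulIf n1); lra.
Qed.

Let meets (x y x' y' : hat P) t : Prop :=
  exists2 v, segment x y t = grid_pos v & (v = x \/ v = y) /\ (v = x' \/ v = y').

Let meets_end (x y x' y' : hat P) (t t' : R) : (t = 0 \/ t = 1) -> hasse x' y' ->
  0 <= t' <= 1 -> segment x y t = segment x' y' t' -> meets x y x' y' t.
Proof.
move=> h xy' t01 e; have [v vE vxy] : exists2 v, segment x y t = grid_pos v
    & v = x \/ v = y.
  by case: h => ->; [exists x|exists y]; rewrite ?segment0 ?segment1; auto.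
exists v => //; split=> //; apply: (grid_vertex xy' t01).
by rewrite -e.
Qed.

Let meets_sym x y x' y' t t' : segment x y t = segment x' y' t' ->
  meets x' y' x y t' -> meets x y x' y' t.
Proof. by move=> e [v h [? ?]]; exists v; rewrite ?e. Qed.

Let neq_nat (i j : nat) : (i < j)%N -> i%:R + 1 <= j%:R :> R.
Proof. by rewrite natr1 ler_nat. Qed.

Let cone_neq (a b c d : R) (m : R) : 0 <= a -> a + 1 <= b -> b + 1 <= m ->
  0 <= c -> c + 1 <= d -> d + 1 <= m -> a < c -> b < d ->
  (a + b - m) * (2 * m + 1 - (d - c)) = (c + d - m) * (2 * m + 1 - (b - a)) ->
  False.
Proof.
move=> a0 ab bm c0 cd dm ac bd e.
have h1 : 0 < (c - a) * (2 * m + 1 - (b - a) + (m - a - b)).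
  by apply: mulr_gt0; lra.
have h2 : 0 < (d - b) * (2 * m + 1 - (b - a) - (m - a - b)).
  by apply: mulr_gt0; lra.
lra.
Qed.

Let grid_meet_end (x y x' y' : hat P) (t t' : R) : hasse x y -> hasse x' y' ->
  0 <= t <= 1 -> 0 <= t' <= 1 -> (x, y) <> (x', y') ->
  segment x y t = segment x' y' t' ->
  (t = 0 \/ t = 1) \/ (t' = 0 \/ t' = 1).
Proof.
have up (p : P) (r s : R) : 0 <= r <= 1 -> 0 <= s <= 1 ->
    (1 - r) * 0 + r * 1 = (1 - s) * ((cell_col p)%:R - (cell_row p)%:R)
      + s * (2 * n%:R + 1) -> r = 1.
  move=> /andP[r0 r1] /andP[s0 s1] e; have [a1 a2 a3] := cell_boundsR p.
  have : 0 <= (1 - s) * ((cell_col p)%:R - (cell_row p)%:R - 1).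
    by apply: mulr_ge0; lra.
  have : 0 <= s * n%:R by apply: mulr_ge0.
  by lra.
have tmax (p q : P) (s u w : R) : (forall q : P, ~~ (p < q)%O) -> 0 <= s <= 1 ->
    (cell_row q)%:R - 1 <= w -> u <= (cell_col q)%:R + 1 ->
    (w = (cell_row q)%:R) \/ (u = (cell_col q)%:R) ->
    (1 - s) * ((cell_row p)%:R + (cell_col p)%:R) + s * n%:R = u + w ->
    (1 - s) * ((cell_col p)%:R - (cell_row p)%:R) + s * (2 * n%:R + 1) = u - w ->
    s = 0.
  move=> pmax /andP[s0 s1] hw hu wu e1 e2; have [a1 a2 a3] := cell_boundsR p.
  apply/eqP; case: eqVneq => // sn0; exfalso.
  have sp : 0 < s by rewrite lt_neqAle eq_sym sn0.
  have w1 : w < (cell_row p)%:R.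
    have : 0 < s * (2 * (cell_row p)%:R + n%:R + 1) by apply: mulr_gt0; lra.
    by lra.
  have u1 : (cell_col p)%:R < u.
    have : 0 < s * (3 * n%:R + 1 - 2 * (cell_col p)%:R) by apply: mulr_gt0; lra.
    by lra.
  have h1 : (cell_row q < (cell_row p).+1)%N by rewrite -(ltr_nat R) -natr1; lra.
  have h2 : (cell_col p < (cell_col q).+1)%N by rewrite -(ltr_nat R) -natr1; lra.
  apply: (cell_lt_maxF pmax h1 h2).
  by case: wu => wu; [left|right]; rewrite -(ltr_nat R) -wu.
move=> xy xy' t01 t01' ne e.
have /andP[tg tl] := t01; have /andP[tg' tl'] := t01'.
have En (x0 y0 : R) z : (x0, y0) = z -> x0 = z.1 /\ y0 = z.2 by move=> <-.
case: (grid_edgeP xy) ne e => [p hp|p q hr hc|p q hr hc|p pmax|nP];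
case: (grid_edgeP xy') => [p' hp'|p' q' hr' hc'|p' q' hr' hc'|p' pmax'|nP'];
move=> ne; rewrite /segment ?posE ?pos0E ?pos1E; case/En; rewrite /=;
rewrite ?hp ?hp' ?hr ?hr' ?hc ?hc' -?natr1 => e1 e2;
try (have := cell_boundsR p; rewrite ?hp ?hp' ?hr ?hr' ?hc ?hc' -?natr1 => -[a1 a2 a3]);
try (have := cell_boundsR p'; rewrite ?hp ?hp' ?hr ?hr' ?hc ?hc' -?natr1 => -[a1' a2' a3']).
- left; case: (eqVneq t 0) => [|t0]; [by left|exfalso; apply: ne].
  congr (_, inl _); have ett : t = t' by lra.
  have er : cell_row p = cell_row p'.
    by apply/eqP; rewrite -(eqr_nat R); apply/eqP; apply: (mulfI t0); subst t'; lra.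
  by apply: skew_cell_inj; rewrite ?hp ?hp' er.
- by left; right; lra.
- by left; right; lra.
- by left; right; apply: (up p' t t') => //; lra.
- by case: (nP' p).
- by right; right; lra.
- case: (ltngtP (cell_col p) (cell_col p')) => [/neq_nat h|/neq_nat h|h].
  + by left; right; lra.
  + by left; left; lra.
  + exfalso; apply: ne; have er : cell_row p = cell_row p'.
      by apply/eqP; rewrite -(eqr_nat R); apply/eqP; lra.
    by congr (inl _, inl _); apply: skew_cell_inj; rewrite ?hr ?hr' ?hc ?hc' ?er ?h.
- by left; apply: (@nat01 (cell_col p) (cell_col p')); lra.
- by right; left; apply: (tmax p' p t' ((cell_col p)%:R + t) (cell_row p)%:R) => //; rewrite ?hr; try lra; left.
- by case: (nP' p).
- by right; right; lra.
- by right; apply: (@nat01 (cell_col p') (cell_col p)); lra.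
- case: (ltngtP (cell_row q) (cell_row q')) => [/neq_nat h|/neq_nat h|h].
  + by left; left; lra.
  + by left; right; lra.
  + exfalso; apply: ne; have er : cell_col p = cell_col p'.
      by apply/eqP; rewrite -(eqr_nat R); apply/eqP; lra.
    by congr (inl _, inl _); apply: skew_cell_inj; rewrite ?hr ?hr' ?hc ?hc' ?er ?h.
- by right; left; apply: (tmax p' p t' (cell_col p)%:R ((cell_row p)%:R - t)) => //; rewrite ?hr -?natr1; try lra; right.
- by case: (nP' p).
- by right; right; apply: (up p t' t) => //; lra.
- by left; left; apply: (tmax p p' t ((cell_col p')%:R + t') (cell_row p')%:R) => //; rewrite ?hr'; try lra; left.
- by left; left; apply: (tmax p p' t (cell_col p')%:R ((cell_row p')%:R - t')) => //; rewrite ?hr' -?natr1; try lra; right.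
- left; case: (eqVneq t 1) => [|t1]; [by right|exfalso].
  have t1p : 0 < 1 - t by rewrite subr_gt0 lt_neqAle t1.
  set r := (cell_row p)%:R in a1 a2 a3 e1 e2; set c := (cell_col p)%:R in a1 a2 a3 e1 e2.
  set r' := (cell_row p')%:R in a1' a2' a3' e1 e2.
  set c' := (cell_col p')%:R in a1' a2' a3' e1 e2.
  have f1 : (1 - t) * (r + c - n%:R) = (1 - t') * (r' + c' - n%:R) by lra.
  have f2 : (1 - t) * (2 * n%:R + 1 - (c - r))
          = (1 - t') * (2 * n%:R + 1 - (c' - r')) by lra.
  have t1p' : 1 - t' != 0.
    apply/eqP => t'1; rewrite t'1 mul0r in f2.
    have : 0 < (1 - t) * (2 * n%:R + 1 - (c - r)) by apply: mulr_gt0; lra.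
    by rewrite f2 ltxx.
  have f : (r + c - n%:R) * (2 * n%:R + 1 - (c' - r'))
         = (r' + c' - n%:R) * (2 * n%:R + 1 - (c - r)).
    apply: (mulfI (lt0r_neq0 t1p)); apply: (mulfI t1p').
    transitivity ((1 - t) * (r + c - n%:R) *
      ((1 - t') * (2 * n%:R + 1 - (c' - r')))); first by ring.
    by rewrite f1 -f2; ring.
  have pm := pmax p'; have pm' := pmax' p.
  case: (ltngtP (cell_row p) (cell_row p')) => h1;
  case: (ltngtP (cell_col p) (cell_col p')) => h2.
  + by apply: cone_neq f; rewrite ?ltr_nat.
  + exact: (cell_lt_maxF pmax' (ltnW h1) (ltnW h2) (or_introl h1)).
  + exact: (cell_lt_maxF pmax' (ltnW h1) (eq_leq (esym h2)) (or_introl h1)).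
  + exact: (cell_lt_maxF pmax (ltnW h1) (ltnW h2) (or_introl h1)).
  + by apply: (cone_neq _ _ _ _ _ _ _ _ (esym f)); rewrite ?ltr_nat.
  + exact: (cell_lt_maxF pmax (ltnW h1) (eq_leq h2) (or_introl h1)).
  + exact: (cell_lt_maxF pmax (eq_leq (esym h1)) (ltnW h2) (or_intror h2)).
  + exact: (cell_lt_maxF pmax' (eq_leq h1) (ltnW h2) (or_intror h2)).
  + by apply: ne; congr (inl _, _); apply: skew_cell_inj.
- by case: (nP' p).
- by case: (nP p').
- by case: (nP p').
- by case: (nP p').
- by case: (nP p').
- by case: ne.
Qed.

Lemma grid_planar (x y x' y' : hat P) (t t' : R) : hasse x y -> hasse x' y' ->
  0 <= t <= 1 -> 0 <= t' <= 1 -> (x, y) <> (x', y') ->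
  segment x y t = segment x' y' t' -> meets x y x' y' t.
Proof.
move=> xy xy' t01 t01' ne e.
case: (grid_meet_end xy xy' t01 t01' ne e) => h.
  exact: meets_end h xy' t01' e.
by apply: (meets_sym e); apply: meets_end h xy t01 (esym e).
Qed.

Lemma grid_upward x y : hasse x y -> (grid_pos x).2 < (grid_pos y).2.
Proof.
move=> xy; case: (grid_edgeP xy) => [p hp|p q hr hc|p q hr hc|p pmax|nP];
  rewrite ?posE ?pos0E ?pos1E /= ?hr ?hc -?natr1 ?natrD;
  try (have [a1 a2 a3] := cell_boundsR p); have := n_ge0; try clear nP; lra.
Qed.

Definition grid_embedding : upward_embedding P R := {|
  pos := grid_pos;
  pos_inj := grid_pos_inj;
  pos_upward := fun e => grid_upward (valP e);
  pos_vertex := fun v e t => @grid_vertex v _ _ t (valP e);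
  pos_planar := fun e e' t t' t01 t01' ne =>
    @grid_planar _ _ _ _ t t' (valP e) (valP e') t01 t01'
      (fun h => ne (val_inj (etrans (surjective_pairing _)
                  (etrans h (esym (surjective_pairing _))))))
|}.

End GridEmbedding.

(* Main.v *)
(** The sums of the entries in the north-east corners determine a matrix; on the
    face they are forced to be [i - j] below the diagonal and [0] on [lam], and
    the inequalities of the alternating sign matrix polytope say exactly that the
    remaining ones are decreasing along the poset with values in [0, 1]. So
    [x p := 1 - corner sum at p] is an affine bijection onto the order polytope.

    A point [x] of an order polytope, extended by [x hat0 = 0] and [x hat1 = 1],
    gives the flow [x (upper e) - x (lower e)] on the edge dual to [e]: the balance
    at a face is a telescoping sum along its boundary. Conversely, given a flow,
    define [x] by summing it along a spanning tree of the Hasse diagram in which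
    every element keeps its leftmost down-edge. Every face then has at most one
    edge outside the tree with that face on its left, and an induction on the
    faces from left to right, using the balance at each face, shows that the flow
    is the gradient of [x] along the other edges as well. The left-to-right order
    and the uniqueness are read off an explicit labelling of the faces
    by their lowest corner in the grid. *)

Require Import Defs.
From HB Require Import structures.
From mathcomp Require Import all_boot all_order all_algebra.
From mathcomp Require Import zify ring lra.

Set Implicit Arguments.
Unset Strict Implicit.
Unset Printing Implicit Defensive.

Import Order.TTheory GRing.Theory Num.Theory.
Local Open Scope ring_scope.

Lemma affine_equiv_trans (R : realFieldType) (U V W : lmodType R)
    (A : U -> Prop) (B : V -> Prop) (C : W -> Prop) :
  affine_equiv A B -> affine_equiv B C -> affine_equiv A C.
Proof.
move=> [L [b [AB Li Ls]]] [M [c [BC Mi Ms]]].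
exists (M \o L : {linear U -> W}), (M b + c).
have E x : (M \o L) x + (M b + c) = M (L x + b) + c by rewrite linearD addrA.
split=> [x Ax|x y Ax Ay|y Cy]; rewrite ?E.
- exact/BC/AB.
- by move/(Mi _ _ (AB _ Ax) (AB _ Ay)); apply: Li.
have [z Bz <-] := Ms y Cy; have [x Ax <-] := Ls z Bz.
by exists x => //; rewrite E.
Qed.

(** * Corner sums and the order polytope *)

Section CornerSums.
Context (R : realFieldType) (n : nat) (lam : stair_partition n).
Let P := skew_cell lam.
Implicit Types (A : 'M[R]_n) (x : {ffun P -> R^o}).

(** The bound on rows is strict and the one on columns is not: the corner with tip [(i, j)] is
    [corner_sum A i.+1 j], while [i = 0] and [j = n] give empty corners. *)
Definition corner_sum A (i j : nat) : R :=
  \sum_(a < n | (a < i)%N) \sum_(b < n | (j <= b)%N) A a b.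

Lemma sum_ord_recr (F : 'I_n -> R) (i : 'I_n) :
  \sum_(a < n | (a < i.+1)%N) F a = \sum_(a < n | (a < i)%N) F a + F i.
Proof.
rewrite (bigD1 i) /= ?ltnS // addrC; congr (_ + _); apply: eq_bigl => a.
by rewrite ltnS ltn_neqAle andbC.
Qed.

Lemma sum_ord_recl (F : 'I_n -> R) (j : 'I_n) :
  \sum_(b < n | (j <= b)%N) F b = F j + \sum_(b < n | (j < b)%N) F b.
Proof.
rewrite (bigD1 j) /= ?leqnn //; congr (_ + _); apply: eq_bigl => b.
by rewrite ltn_neqAle eq_sym andbC.
Qed.

Lemma corner_sumSl A (i : 'I_n) j :
  corner_sum A i.+1 j = corner_sum A i j + \sum_(b < n | (j <= b)%N) A i b.
Proof. exact: sum_ord_recr. Qed.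

Lemma corner_sumSr A i (j : 'I_n) :
  corner_sum A i j = corner_sum A i j.+1 + \sum_(a < n | (a < i)%N) A a j.
Proof.
by rewrite addrC -big_split; apply: eq_bigr => a _; apply: sum_ord_recl.
Qed.

Lemma corner_sum_entry A (i j : 'I_n) :
  A i j = corner_sum A i.+1 j - corner_sum A i j
        - (corner_sum A i.+1 j.+1 - corner_sum A i j.+1).
Proof. by rewrite !corner_sumSl (sum_ord_recl _ j); ring. Qed.

Definition cell_at (i j : nat) : option P :=
  [pick p : P | (cell_row p == i) && (cell_col p == j)].

(* The corner sums of the matrix corresponding to [x]: the entries below the
   subdiagonal vanish, hence the value [i - j] when [j < i]. *)
Definition poset_corner x (i j : nat) : R :=
  if (j < i)%N then (i - j)%:R
  else if i is i'.+1 then if cell_at i' j is Some p then 1 - x p else 0 else 0.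

Lemma cell_at_cell (p : P) : cell_at (cell_row p) (cell_col p) = Some p.
Proof.
rewrite /cell_at; case: pickP => [q /andP[/eqP a /eqP b]|/(_ p)].
  by congr Some; apply: skew_cell_inj.
by rewrite !eqxx.
Qed.

Lemma cell_atP i j : (i < j)%N -> (j < n)%N ->
  (exists p : P, [/\ cell_row p = i, cell_col p = j & cell_at i j = Some p])
  \/ (in_diagram lam i j /\ cell_at i j = None).
Proof.
move=> ij jn; case D: (in_diagram lam i j).
  right; split=> //; rewrite /cell_at; case: pickP => // p /andP[/eqP a /eqP b].
  by have := cell_notin p; rewrite a b D.
left; have iN := ltn_trans ij jn.
have H : (Ordinal iN < Ordinal jn)%N && ~~ in_diagram lam (Ordinal iN) (Ordinal jn).
  by rewrite /= ij D.
pose p : P := exist _ (Ordinal iN, Ordinal jn) H.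
by exists p; split=> //; rewrite -(cell_at_cell p).
Qed.

Lemma poset_corner_cell x (p : P) :
  poset_corner x (cell_row p).+1 (cell_col p) = 1 - x p.
Proof.
have /andP[a _] := cell_bounds p.
by rewrite /poset_corner ltnS leqNgt a /= cell_at_cell.
Qed.

Lemma poset_corner_cell_at x (p : P) i j : cell_row p = i -> cell_col p = j ->
  poset_corner x i.+1 j = 1 - x p.
Proof. by move=> <- <-; apply: poset_corner_cell. Qed.

Lemma poset_corner0 x j : poset_corner x 0 j = 0.
Proof. by []. Qed.

Lemma poset_cornern x i : (i <= n)%N -> poset_corner x i n = 0.
Proof.
rewrite /poset_corner ltnNge => -> /=; case: i => // i.
rewrite /cell_at; case: pickP => // p /andP[_ /eqP e].
by have := cell_bounds p; rewrite e ltnn andbF.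
Qed.

Lemma poset_corner_lt x i j : (j < i)%N -> poset_corner x i j = (i - j)%:R.
Proof. by rewrite /poset_corner => ->. Qed.

Lemma poset_corner_diagram x i j : (i < j)%N -> (j < n)%N ->
  in_diagram lam i j -> poset_corner x i.+1 j = 0.
Proof.
move=> ij jn D; rewrite /poset_corner ltnS leqNgt ij /=.
case: (cell_atP ij jn) => [[p [a b _]]|[_ ->]] //.
by have := cell_notin p; rewrite a b D.
Qed.

(** * Bounds and monotonicity of the corner sums built from a point of the order polytope *)

Section Bounds.
Variables (x : {ffun P -> R^o}) (Ox : order_polytope R P x).

Let x01 p : 0 <= (x p : R) <= 1 := Ox.1 p.

Lemma poset_corner_bounds i j : (i <= j)%N -> 0 <= poset_corner x i j <= 1.
Proof.
rewrite /poset_corner ltnNge => -> /=; case: i => [|i]; first by lra.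
by case: (cell_at i j) => [p|]; first have := x01 p; lra.
Qed.

(** If [(i-1, j)] is a cell, then so is [(i, j)], and it is smaller in the poset; otherwise the left
    side is 0. *)
Lemma poset_corner_monol i j : (i < j)%N ->
  poset_corner x i j <= poset_corner x i.+1 j.
Proof.
move=> ij; case: (ltnP j n) => jn; last first.
  suff E k : (k <= j)%N -> poset_corner x k j = 0 by rewrite !E // ltnW.
  rewrite /poset_corner ltnNge => -> /=; case: k => // k; rewrite /cell_at.
  by case: pickP => // p /andP[_ /eqP e]; have := cell_bounds p; lia.
case: i ij => [|i] ij; first by have := poset_corner_bounds ij; rewrite poset_corner0; lra.
case: (cell_atP (ltnW ij) jn) => [[p [a b _]]|[D _]].
  have [||q [c e]] := @cell_ex n lam p i.+1 j ij; rewrite ?a ?b //.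
  rewrite (poset_corner_cell_at x a b) (poset_corner_cell_at x c e).
  by have := Ox.2 q p; rewrite lerD2l lerN2; apply; apply/andP; lia.
rewrite (poset_corner_diagram x (ltnW ij) jn D).
by have /andP[] := poset_corner_bounds ij.
Qed.

Lemma poset_corner_monor i j : (i <= j)%N ->
  poset_corner x i j.+1 <= poset_corner x i j.
Proof.
case: i => [|i] ij; first by rewrite !poset_corner0.
case: (ltnP j.+1 n) => jn; last first.
  have -> : poset_corner x i.+1 j.+1 = 0.
    rewrite /poset_corner ltnNge leqW // /cell_at.
    by case: pickP => // p /andP[_ /eqP e]; have := cell_bounds p; lia.
  by have /andP[] := poset_corner_bounds ij.
case: (cell_atP (leqW ij) jn) => [[p [a b _]]|[D _]].
  have [||q [c e]] := @cell_ex n lam p i j ij; rewrite ?a ?b //.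
  rewrite (poset_corner_cell_at x a b) (poset_corner_cell_at x c e).
  by have := Ox.2 q p; rewrite lerD2l lerN2; apply; apply/andP; lia.
rewrite (poset_corner_diagram x (leqW ij) jn D).
by have /andP[] := poset_corner_bounds ij.
Qed.

(** The difference is a tail sum of row [i] of the matrix to be built. It is exactly 1 for [j < i];
    for [i = j] the forced value 1 is compared with a value in [0, 1]. *)
Lemma poset_corner_stepl i j : 0 <= poset_corner x i.+1 j - poset_corner x i j <= 1.
Proof.
case: (ltngtP i j) => ij.
- have := poset_corner_monol ij; have := poset_corner_bounds ij.
  by have := poset_corner_bounds (ltnW ij); lra.
- rewrite !poset_corner_lt ?subSn -?natr1 //; [lra|lia..].
- rewrite ij poset_corner_lt // subSnn.
  by have := poset_corner_bounds (leqnn j); lra.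
Qed.

(** Same argument for the sum of the first [i] entries of column [j]. *)
Lemma poset_corner_stepr i j : 0 <= poset_corner x i j - poset_corner x i j.+1 <= 1.
Proof.
case: (leqP i j) => ij.
  have := poset_corner_monor ij; have := poset_corner_bounds ij.
  by have := poset_corner_bounds (leqW ij); lra.
move: ij; rewrite leq_eqVlt => /orP[/eqP <-|ij].
  rewrite poset_corner_lt // subSnn.
  by have := poset_corner_bounds (leqnn j.+1); lra.
by rewrite !poset_corner_lt ?(subnSK) ?(ltnW ij) // -(subnSK (ltnW ij)) -natr1; lra.
Qed.

End Bounds.

(** * Passing between matrices and corner sums *)

Lemma corner_sum0 A j : corner_sum A 0 j = 0.
Proof. by apply: big_pred0. Qed.

Lemma corner_sumn A i : corner_sum A i n = 0.
Proof.
by apply: big1 => a _; apply: big_pred0 => b; rewrite leqNgt ltn_ord.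
Qed.

Definition matrix_of_corner (S : nat -> nat -> R) : 'M[R]_n :=
  \matrix_(i, j) (S i.+1 j - S i j - (S i.+1 j.+1 - S i j.+1)).

(** The entries are second differences of [S], so their sum over a corner telescopes, and the
    boundary terms vanish. Rows are added from the top and, within a row, columns from the right. *)
Lemma matrix_of_cornerK (S : nat -> nat -> R) i j :
  (forall j, S 0%N j = 0) -> (forall i, (i <= n)%N -> S i n = 0) ->
  (i <= n)%N -> (j <= n)%N -> corner_sum (matrix_of_corner S) i j = S i j.
Proof.
move=> S0 Sn; elim: i => [|i IHi] iN jN; first by rewrite corner_sum0.
rewrite (corner_sumSl _ (Ordinal iN)) /= (IHi (ltnW iN) jN).
rewrite -[S i.+1 j](subrKC (S i j)).
congr (_ + _); rewrite -(subKn jN); set k := (n - j)%N.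
have : (k <= n)%N by rewrite leq_subr.
elim: k => [|k IHk] kn.
  rewrite subn0 !Sn ?subrr ?(ltnW iN) //; apply: big_pred0 => b.
  by rewrite leqNgt ltn_ord.
have ltk : (n - k.+1 < n)%N by lia.
rewrite (sum_ord_recl _ (Ordinal ltk)) [nat_of_ord (Ordinal ltk)]/=.
have -> : \sum_(b < n | (n - k.+1 < b)%N) matrix_of_corner S (Ordinal iN) b
   = \sum_(b < n | (n - k <= b)%N) matrix_of_corner S (Ordinal iN) b.
  by apply: eq_bigl => b; lia.
rewrite (IHk (ltnW kn)) mxE /= (_ : (n - k.+1).+1 = (n - k)%N); last by lia.
by ring.
Qed.

Lemma corner_sum_full A i : (forall i, \sum_(j < n) A i j = 1) ->
  (i <= n)%N -> corner_sum A i 0 = i%:R.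
Proof.
move=> A1; elim: i => [|i IH] iN; first by rewrite corner_sum0.
by rewrite (corner_sumSl _ (Ordinal iN)) /= (IH (ltnW iN)) A1 natr1.
Qed.

(** When [j.+1 < i], column [j] vanishes from row [i] on, so its first [i] entries already sum to 1.
    Dropping columns one by one thus lowers the full sum [i] by 1 each time. *)
Lemma asm_corner_below A i j : asm_face R lam A -> (i <= n)%N ->
  (j < i)%N -> corner_sum A i j = (i - j)%:R.
Proof.
move=> [[_ _ col1 row1] low _] iN ji.
elim: j ji => [|j IH] ji.
  by rewrite corner_sum_full // subn0.
have jn : (j < n)%N by lia.
have := corner_sumSr A i (Ordinal jn); rewrite (IH (ltnW ji)) /=.
have -> : \sum_(a < n | (a < i)%N) A a (Ordinal jn) = 1.
  rewrite -(col1 (Ordinal jn)) [RHS](bigID (fun a : 'I_n => (a < i)%N)) /=.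
  rewrite [X in _ + X]big1 ?addr0 // => a; rewrite -leqNgt => ia.
  by apply: low => /=; lia.
by rewrite -(subnSK (ltnW ji)) -natr1 => /addIr <-.
Qed.

Lemma asm_corner_diagram A i j : asm_face R lam A -> in_diagram lam i j ->
  corner_sum A i.+1 j = 0.
Proof.
move=> [_ _ dia] D; apply: big1 => a ai; apply: big1 => b jb; apply: dia.
exact: in_diagram_mono D.
Qed.

(** Adding a row to a corner adds a tail sum of that row, the complement to 1 of a partial sum;
    adding a column adds a partial column sum. Both are nonnegative. *)
Lemma asm_corner_mono A i j i' j' : asm_polytope A -> (i <= i')%N -> (i' <= n)%N ->
  (j' <= j)%N -> (j <= n)%N -> corner_sum A i j <= corner_sum A i' j'.
Proof.
move=> [colA rowA col1 row1] ii iN jj jN.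
apply: (@le_trans _ _ (corner_sum A i' j)).
  elim: i' ii iN => [|k IH]; first by rewrite leqn0 => /eqP ->.
  rewrite leq_eqVlt => /orP[/eqP -> //|ik] kN.
  apply: le_trans (IH ik (ltnW kN)) _.
  rewrite (corner_sumSl _ (Ordinal kN)) lerDl.
  case: j jN {jj IH} => [|j] jN; first by rewrite row1 ler01.
  have /andP[_] := rowA (Ordinal kN) (Ordinal jN); rewrite -(row1 (Ordinal kN)).
  rewrite [X in _ <= X](bigID (fun b : 'I_n => (b <= j)%N)) /= lerDl.
  by congr (_ <= _); apply: eq_bigl => b; rewrite -ltnNge.
elim: j jj jN => [|k IH]; first by rewrite leqn0 => /eqP ->.
rewrite leq_eqVlt => /orP[/eqP -> //|ik] kN.
apply: le_trans (IH ik (ltnW kN)).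
rewrite (corner_sumSr _ _ (Ordinal kN)) lerDl.
case: i' {ii IH} iN => [|i'] iN; first by rewrite big_pred0.
by have /andP[] := colA (Ordinal iN) (Ordinal kN).
Qed.

Definition corner_map A : {ffun P -> R^o} :=
  [ffun p => - corner_sum A (cell_row p).+1 (cell_col p)].

Fact corner_map_is_linear : linear corner_map.
Proof.
move=> a A B; apply/ffunP => p; rewrite !ffunE scalerN -opprD; congr (- _).
rewrite /corner_sum scaler_sumr -big_split; apply: eq_bigr => i _.
by rewrite scaler_sumr -big_split; apply: eq_bigr => j _; rewrite !mxE.
Qed.
HB.instance Definition _ :=
  GRing.isLinear.Build R 'M[R]_n {ffun P -> R^o} *:%R corner_map corner_map_is_linear.

Definition ones : {ffun P -> R^o} := [ffun => 1].

(** On the face every corner sum, not only those at cells, is determined by the image point;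
    injectivity of the map follows. *)
Lemma asm_cornerE A i j : asm_face R lam A -> (i <= n)%N -> (j <= n)%N ->
  corner_sum A i j = poset_corner (corner_map A + ones) i j.
Proof.
move=> FA iN jN; case: (ltnP j i) => ji.
  by rewrite poset_corner_lt // asm_corner_below.
move: jN; rewrite leq_eqVlt => /orP[/eqP ->|jn].
  by rewrite corner_sumn poset_cornern.
case: i ji iN => [|i] ij iN; first by rewrite corner_sum0 poset_corner0.
case: (cell_atP ij jn) => [[p [a b _]]|[D _]].
  by rewrite -a -b poset_corner_cell !ffunE opprD opprK addrC subrK.
by rewrite poset_corner_diagram // asm_corner_diagram.
Qed.

Lemma corner_map_order A : asm_face R lam A ->
  order_polytope R P (corner_map A + ones).
Proof.
move=> FA; have [PA _ _] := FA.
have E p : (corner_map A + ones) p = 1 - corner_sum A (cell_row p).+1 (cell_col p).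
  by rewrite !ffunE addrC.
have [_ rowA _ row1] := PA.
split=> [p|p q /andP[qp pq]]; rewrite !E; last first.
  have /andP[p1 p2] := cell_bounds p; have /andP[q1 q2] := cell_bounds q.
  have := @asm_corner_mono A (cell_row q).+1 (cell_col q) (cell_row p).+1 (cell_col p).
  by move=> /(_ PA); rewrite lerD2l lerN2; apply; lia.
have /andP[p1 p2] := cell_bounds p.
have H0 : 0 <= corner_sum A (cell_row p).+1 (cell_col p).
  by rewrite -(corner_sum0 A (cell_col p)); apply: asm_corner_mono => //; lia.
suff H1 : corner_sum A (cell_row p).+1 (cell_col p) <= 1 by lra.
(* Enlarge the corner downward to the first row below the diagonal, where its sum is forced to be
   1. *)
apply: (@le_trans _ _ (corner_sum A (cell_col p).+1 (cell_col p))).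
  by apply: asm_corner_mono => //; lia.
by rewrite asm_corner_below // subSnn.
Qed.

Lemma order_corner_asm x : order_polytope R P x ->
  asm_face R lam (matrix_of_corner (poset_corner x)).
Proof.
move=> Ox; set B := matrix_of_corner _.
have E i j : (i <= n)%N -> (j <= n)%N -> corner_sum B i j = poset_corner x i j.
  by move=> iN jN; apply: matrix_of_cornerK => // k; apply: poset_cornern.
have colE i (j : 'I_n) : (i <= n)%N ->
    \sum_(a < n | (a < i)%N) B a j = poset_corner x i j - poset_corner x i j.+1.
  move=> iN; rewrite -!E ?(ltnW (ltn_ord j)) //.
  by rewrite (corner_sumSr B i j) addrC addKr.
have rowE (i : 'I_n) j : (j <= n)%N ->
    \sum_(b < n | (j <= b)%N) B i b = poset_corner x i.+1 j - poset_corner x i j.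
  move=> jN; rewrite -!E ?(ltnW (ltn_ord i)) //.
  by rewrite (corner_sumSl B i j) addrC addKr.
have row1 i : \sum_(b < n) B i b = 1.
  rewrite (eq_bigl (fun b : 'I_n => (0 <= b)%N)) // rowE //.
  rewrite poset_corner_lt // /poset_corner.
  case: i => -[|i] iN /=; first by rewrite subr0.
  by rewrite !subn0 -(natr1 i.+1) addrC addKr.
split; first split=> //.
(* The minimum covers an [i'] beyond the last row. *)
- move=> i' j; rewrite (eq_bigl (fun a : 'I_n => (a < minn i'.+1 n)%N)).
    by rewrite colE ?geq_minr //; apply: poset_corner_stepr Ox _ _.
  by move=> a; rewrite leq_min ltn_ord andbT.
(* A partial row sum is 1 minus a tail sum, and tail sums are the steps of [poset_corner]. *)
- move=> i j'; have := poset_corner_stepl Ox i (minn j'.+1 n).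
  rewrite -rowE ?geq_minr // => H; have := row1 i.
  rewrite (bigID (fun b : 'I_n => (b <= j')%N)) /=.
  rewrite [X in _ + X](eq_bigl (fun b : 'I_n => (minn j'.+1 n <= b)%N)).
    move: H; move: (\sum_(b < n | (minn j'.+1 n <= b)%N) B i b) => u H.
    by move: (\sum_(b < n | (b <= j')%N) B i b) => w e; lra.
  by move=> b; rewrite geq_min [(n <= b)%N]leqNgt ltn_ord orbF -ltnNge.
- move=> j; rewrite (eq_bigl (fun a : 'I_n => (a < n)%N)); last first.
    by move=> a; rewrite ltn_ord.
  rewrite colE // poset_corner_lt //.
  case: (ltnP j.+1 n) => jn; last first.
    have -> : j.+1 = n by have := ltn_ord j; lia.
    have -> : (n - j)%N = 1%N by have := ltn_ord j; lia.
    by rewrite poset_cornern // subr0.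
  by rewrite poset_corner_lt // -(subnSK (ltn_ord j)) -natr1 addrC addKr.
- move=> i j ij; rewrite mxE !poset_corner_lt; try lia.
  have -> : (i.+1 - j = (i - j.+1).+2)%N by lia.
  have -> : (i - j = (i - j.+1).+1)%N by lia.
  have -> : (i.+1 - j.+1 = (i - j.+1).+1)%N by lia.
  by rewrite -!natr1; ring.
(* All four corner values entering an entry in the diagram vanish. *)
move=> i j D; have Z a b : (a <= i.+1)%N -> (j <= b)%N -> (b <= n)%N ->
    poset_corner x a b = 0.
  move=> ai jb; rewrite leq_eqVlt => /orP[/eqP ->|bn].
    by rewrite poset_cornern //; have := ltn_ord i; lia.
  have ij : (i < j)%N.
    by move: D => /andP[/(parts_stair) h]; have := ltn_ord i; lia.
  case: a ai => [|a] ai; first by rewrite poset_corner0.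
  apply: poset_corner_diagram => //; first by lia.
  exact: in_diagram_mono D.
by rewrite mxE !Z ?subr0 //; have := ltn_ord j; lia.
Qed.

Lemma asm_face_order : affine_equiv (asm_face R lam) (order_polytope R P).
Proof.
exists (corner_map : {linear 'M[R]_n -> {ffun P -> R^o}}), ones; split.
- exact: corner_map_order.
- move=> A B FA FB e; apply/matrixP => i j.
  have [iN jN] := (ltn_ord i, ltn_ord j).
  have E a b : (a <= n)%N -> (b <= n)%N -> corner_sum A a b = corner_sum B a b.
    by move=> aN bN; rewrite !asm_cornerE // e.
  by rewrite (corner_sum_entry A) (corner_sum_entry B) !E // ltnW.
move=> x Ox; exists (matrix_of_corner (poset_corner x)).
  exact: order_corner_asm.
apply/ffunP => p; have /andP[p1 p2] := cell_bounds p.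
rewrite !ffunE matrix_of_cornerK ?poset_corner_cell; first last.
- exact: ltnW.
- by lia.
- by move=> i; apply: poset_cornern.
- by [].
by rewrite opprB subrK.
Qed.

End CornerSums.

(** * Order polytopes and flow polytopes of truncated duals *)

Section Hat.
Context (d : Order.disp_t) (P : finPOrderType d).
Implicit Types (x y z v : hat P) (e : hasse_edge P).

Lemma hat_lt_trans : transitive (@hat_lt d P).
Proof.
move=> [q|[]] [p|[]] [r|[]] //=; exact: lt_trans.
Qed.

Lemma hat_lt_irr x : hat_lt x x = false.
Proof. by case: x => [p|[]] //=; rewrite ltxx. Qed.

(** Measure for inductions along the order; comparing the heights of its two ends also tells whether
    a dart goes up or down. *)
Definition height v : nat := #|[pred z | hat_lt z v]|.

Lemma height_lt x y : hat_lt x y -> (height x < height y)%N.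
Proof.
move=> xy; apply: proper_card; apply/properP; split.
  by apply/subsetP => z; rewrite !inE => /hat_lt_trans; apply.
by exists x; rewrite !inE ?xy ?hat_lt_irr.
Qed.

Lemma hasse_height e : (height (lower e) < height (upper e))%N.
Proof. by apply: height_lt; case/andP: (valP e). Qed.

(** Among the elements that are at least [x] and below [y], one of maximal height is covered by
    [y]. *)
Lemma hat_lt_hasse x y : hat_lt x y ->
  exists z, hasse z y /\ (z = x \/ hat_lt x z).
Proof.
move=> xy; have Px : hat_lt x y && ((x == x) || hat_lt x x) by rewrite xy eqxx.
case: (@arg_maxnP _ x (fun z => hat_lt z y && ((z == x) || hat_lt x z)) height Px).
move=> z /andP[zy zx] zmax; exists z; split; last first.
  by case/orP: zx => [/eqP|]; [left|right].
rewrite /hasse zy /=; apply/existsPn => w; apply/negP => /andP[zw wy].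
have := zmax w; rewrite wy /= => /(_ _)/wrap[].
  by case/orP: zx => [/eqP <-|xz]; rewrite ?zw ?orbT // (hat_lt_trans xz zw) orbT.
by rewrite /= leqNgt height_lt.
Qed.

Lemma hat0_lt v : v != hat0 P -> hat_lt (hat0 P) v.
Proof. by case: v => [p|[]]. Qed.

Lemma lt_hat1 v : v != hat1 P -> hat_lt v (hat1 P).
Proof. by case: v => [p|[]]. Qed.

Lemma hasse_down v : v != hat0 P -> exists e, upper e = v.
Proof.
by move=> /hat0_lt/hat_lt_hasse[z [zv _]]; exists (exist _ (z, v) zv).
Qed.

Lemma hasse_up v : v != hat1 P -> exists e, lower e = v.
Proof.
move=> /lt_hat1 v1.
case: (@arg_minnP _ (hat1 P) (fun z => hat_lt v z) (@height) v1) => z vz zmin.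
suff vz' : hasse v z by exists (exist _ (v, z) vz').
rewrite /hasse vz; apply/existsPn => w; apply/negP => /andP[vw wz].
by have := zmin w vw; rewrite leqNgt height_lt.
Qed.

Lemma lower_neq_hat1 e : lower e != hat1 P.
Proof.
case: e => -[x y] /= xy; rewrite /lower /=; apply/eqP => E.
by move: xy; rewrite E /hasse; case: y.
Qed.

Lemma upper_neq_hat0 e : upper e != hat0 P.
Proof.
case: e => -[x y] /= xy; rewrite /upper /=; apply/eqP => E.
by move: xy; rewrite E /hasse; case: x => [p|[]].
Qed.

Lemma hasse_edge_inj e e' : lower e = lower e' -> upper e = upper e' -> e = e'.
Proof.
move=> l u; apply: val_inj; rewrite [LHS]surjective_pairing.
by rewrite [RHS]surjective_pairing; congr (_, _).
Qed.

End Hat.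

(** * Boundary walks of faces *)

Section Faces.
Context (d : Order.disp_t) (P : finPOrderType d) (R : realFieldType).
Context (D : upward_embedding P R).
Implicit Types (x y : dart P) (v : hat P) (e : hasse_edge P) (f : {set dart P}).

Local Notation dart := (dart P).

Definition dart_rev x : dart := (x.1, ~~ x.2).
Definition dart_start x : hat P := dart_end (dart_rev x).

Lemma dart_revK : involutive dart_rev.
Proof. by move=> [e b]; rewrite /dart_rev negbK. Qed.

Lemma mem_up_edges v (e : hat_edge P) :
  (e \in up_edges D v) = (dart_start (e, true) == v).
Proof.
rewrite /up_edges /enframe; case: e => [e|b].
  have -> : (dart_start (inl e, true) == v) = (lower e == v) by [].
  case: ifP => _; rewrite ?inE ?mem_rcons ?inE /= mem_map ?mem_sort;
    by [rewrite mem_filter mem_enum andbT | move=> ? ? []].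
rewrite /dart_start /= [hat0 P == v]eq_sym; case: ifP => _.
  by rewrite inE mem_rcons inE; case: b.
by apply/negbTE/mapP => -[].
Qed.

Lemma mem_down_edges v (e : hat_edge P) :
  (e \in down_edges D v) = (dart_start (e, false) == v).
Proof.
rewrite /down_edges /enframe; case: e => [e|b].
  have -> : (dart_start (inl e, false) == v) = (upper e == v) by [].
  case: ifP => _; rewrite ?inE ?mem_rcons ?inE /= mem_map ?mem_sort;
    by [rewrite mem_filter mem_enum andbT | move=> ? ? []].
rewrite /dart_start /= [hat1 P == v]eq_sym; case: ifP => _.
  by rewrite inE mem_rcons inE; case: b.
by apply/negbTE/mapP => -[].
Qed.

Lemma mem_clockwise v x : (x \in clockwise D v) = (dart_start x == v).
Proof.
rewrite /clockwise mem_cat mem_rev; case: x => e b.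
have M (b' : bool) (s : seq (hat_edge P)) : ((e, b) \in [seq (a, b') | a <- s]) = (b == b') && (e \in s).
  apply/mapP/andP => [[a as_ [-> ->]]|[/eqP -> es]]; first by rewrite eqxx.
  by exists e.
by rewrite !M mem_up_edges mem_down_edges; case: b {M}; rewrite /= ?orbF.
Qed.

Lemma uniq_enframe b (s : seq (hasse_edge P)) : uniq s -> uniq (enframe b s).
Proof.
move=> us; have us' : uniq [seq (inl e : hat_edge P) | e <- s].
  by rewrite map_inj_uniq // => ? ? [].
rewrite /enframe; case: b => //=; rewrite rcons_uniq us' mem_rcons inE /= andbT.
by apply/andP; split; apply/mapP => -[].
Qed.

Lemma uniq_clockwise v : uniq (clockwise D v).
Proof.
have I (b : bool) : injective (fun a : hat_edge P => (a, b)) by move=> ? ? [].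
rewrite /clockwise cat_uniq rev_uniq !(map_inj_uniq (I _)) /up_edges /down_edges.
rewrite !uniq_enframe ?sort_uniq; try by apply: filter_uniq; apply: enum_uniq.
rewrite andbT /=; apply/hasPn => x; rewrite mem_rev => /mapP[e _ ->].
by apply/mapP => -[].
Qed.

Lemma dart_start_face_step x : dart_start (face_step D x) = dart_end x.
Proof.
apply/eqP; rewrite -mem_clockwise /face_step mem_next mem_clockwise.
by rewrite /dart_start -[(_, _)]/(dart_rev x) dart_revK.
Qed.

Lemma face_step_inj : injective (face_step D).
Proof.
move=> x y E; have V : dart_end x = dart_end y.
  by rewrite -!dart_start_face_step E.
move: E; rewrite /face_step V => /(can_inj (prev_next (uniq_clockwise _))).
by case: x y {V} => [e b] [e' b'] /= [-> /(can_inj negbK) ->].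
Qed.

Lemma face_sym x y : fconnect (face_step D) x y = fconnect (face_step D) y x.
Proof. exact: (fconnect_sym face_step_inj). Qed.

Lemma mem_face x : x \in face_of D x.
Proof. by rewrite inE connect0. Qed.

Lemma face_of_eq x y : (face_of D x == face_of D y) = (y \in face_of D x).
Proof.
apply/eqP/idP => [->|]; first exact: mem_face.
rewrite inE => xy; apply/setP => z; rewrite !inE.
exact: (same_connect face_sym xy).
Qed.

Lemma face_step_mem x y : (face_step D y \in face_of D x) = (y \in face_of D x).
Proof. by rewrite !inE -(same_fconnect1_r face_step_inj). Qed.

Lemma sum_face_step (V : zmodType) (F : dart -> V) x :
  \sum_(y in face_of D x) F (face_step D y) = \sum_(y in face_of D x) F y.
Proof.
rewrite [RHS](reindex_inj face_step_inj); apply: eq_bigl => y.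
by rewrite face_step_mem.
Qed.

(** [face_step] permutes the darts of a face, and each dart starts where its predecessor ends, so
    starts and ends contribute equal sums. *)
Lemma sum_face_potential (V : zmodType) (X : hat P -> V) x :
  \sum_(y in face_of D x) (X (dart_end y) - X (dart_start y)) = 0.
Proof.
rewrite sumrB; apply/eqP; rewrite subr_eq0; apply/eqP.
rewrite -[RHS]sum_face_step; apply: eq_bigr => y _.
by rewrite dart_start_face_step.
Qed.

Lemma dart_height x : (height (dart_start x) < height (dart_end x))%N = x.2.
Proof.
have H (a : hat_edge P) : (height (dart_start (a, true)) < height (dart_end (a, true)))%N.
  by case: a => [e|b] /=; [exact: hasse_height|exact: height_lt].
case: x => a [] /=; first by rewrite H.
by apply/negbTE; rewrite -leqNgt ltnW //; apply: H.
Qed.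

(** The successor of a dart that ends at the greatest height starts there and cannot lead higher. *)
Lemma face_down x : exists2 y, y \in face_of D x & y.2 = false.
Proof.
case: (@arg_maxnP _ x (fun y => y \in face_of D x) (fun y => height (dart_end y)) (mem_face x)).
move=> y yx ymax; exists (face_step D y); first by rewrite face_step_mem.
have := ymax (face_step D y); rewrite face_step_mem => /(_ yx).
by rewrite -dart_height dart_start_face_step /= leqNgt => /negbTE.
Qed.

(** A dart starting at the least height cannot go down, since its successor starts where it ends. *)
Lemma face_up x : exists2 y, y \in face_of D x & y.2 = true.
Proof.
case: (@arg_minnP _ x (fun y => y \in face_of D x) (fun y => height (dart_start y)) (mem_face x)).
move=> y yx ymin; exists y => //; have := ymin (face_step D y).
rewrite face_step_mem => /(_ yx); rewrite dart_start_face_step => h.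
apply: contraTT (h) => ny; have := dart_height (dart_rev y).
rewrite /dart_start dart_revK /= ny -ltnNge => ->//.
Qed.

Lemma bounded_face_of x : x != (inr false, true) -> x != (inr true, false) ->
  bounded_face D (face_of D x).
Proof.
move=> x1 x2; rewrite /bounded_face imset_f //=; apply: contraNneq x1 => E.
by have := mem_face x; rewrite E unbounded_faceE !inE (negbTE x2) orbF.
Qed.

End Faces.

(* A labelling of the faces from which the dual graph can be understood: crossing
   an edge of the Hasse diagram rightward increases the rank, the [primary] edges
   form a spanning tree of all elements but [hat1], rooted at [hat0], and every
   face has at most one non primary edge with this face on its left. *)
Record face_labelling (d : Order.disp_t) (P : finPOrderType d) (R : realFieldType)
    (D : upward_embedding P R) (T : eqType) := FaceLabelling {
  label :> dart P -> T;
  label_rank : T -> nat;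
  primary : pred (hasse_edge P);
  label_step : forall x, label (face_step D x) = label x;
  label_rank_lt : forall e, (label_rank (label (inl e, true))
                             < label_rank (label (inl e, false)))%N;
  label_source : forall e, label (inl e, false) != label (inr false, false);
  label_sink : forall e, label (inl e, true) != label (inr true, true);
  label_source_sink : label (inr false, false) != label (inr true, true);
  primary_ex : forall p, exists2 e, primary e & upper e = inl p;
  primary_inj : {in primary &, injective (@upper d P)};
  primary_hat1 : forall e, primary e -> upper e != hat1 P;
  label_inj : forall e e', ~~ primary e -> ~~ primary e' ->
    label (inl e, true) = label (inl e', true) -> e = e'
}.

(** * The truncated dual as a network, and its flows as gradients *)

Section OrderFlow.
Context (d : Order.disp_t) (P : finPOrderType d) (R : realFieldType).
Context (D : upward_embedding P R) (T : eqType) (lab : face_labelling D T).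
Local Notation G := (truncated_dual D).
Local Notation rk := (label_rank lab).
Implicit Types (x y : dart P) (v : hat P) (e : hasse_edge P) (f : vertex G).

Lemma label_face x y : y \in face_of D x -> lab y = lab x.
Proof.
rewrite inE => /iter_findex <-; elim: (findex _ _ _) => //= k IH.
by rewrite label_step.
Qed.

(** The rank increases across [e], so its two sides are different faces, and only two frame darts
    lie on the unbounded face. Hence every Hasse edge has a dual edge. *)
Lemma hasse_dual e : [&& bounded_face D (left_face D (inl e)),
  bounded_face D (right_face D (inl e)) & left_face D (inl e) != right_face D (inl e)].
Proof.
rewrite /left_face /right_face !bounded_face_of //= face_of_eq.
apply/negP => /label_face E.
by have := label_rank_lt lab e; rewrite E ltnn.
Qed.

Definition dual_of e : edge G := exist _ e (hasse_dual e).

Lemma dual_of_val (e : edge G) : dual_of (val e) = e.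
Proof. exact: val_inj. Qed.

Lemma mem_vertex f y : (y \in val f) = (face_of D y == val f).
Proof.
have /andP[/imsetP[x _ ->] _] := valP f.
by rewrite eq_sym face_of_eq.
Qed.

Lemma vertex_ex f : exists x, val f = face_of D x.
Proof. by have /andP[/imsetP[x _ ->] _] := valP f; exists x. Qed.

Lemma tailE (e : edge G) f : (edge_tail e == f) = ((inl (val e), true) \in val f).
Proof. by rewrite mem_vertex -val_eqE. Qed.

Lemma headE (e : edge G) f : (edge_head e == f) = ((inl (val e), false) \in val f).
Proof. by rewrite mem_vertex -val_eqE. Qed.

Lemma sourceE f : (source G == f) = ((inr false, false) \in val f).
Proof. by rewrite mem_vertex -val_eqE. Qed.

Lemma sinkE f : (sink G == f) = ((inr true, true) \in val f).
Proof. by rewrite mem_vertex -val_eqE. Qed.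

Lemma label_vertex f x y : x \in val f -> y \in val f -> lab x = lab y.
Proof. by have [z ->] := vertex_ex f => /label_face -> /label_face ->. Qed.

Lemma source_neq_sink : source G != sink G.
Proof.
apply/negP; rewrite eq_sym sinkE => /label_face E.
by have := label_source_sink lab; rewrite E eqxx.
Qed.

Lemma head_source (e : edge G) : edge_head e != source G.
Proof.
apply/negP; rewrite headE => /label_face E.
by have := label_source lab (val e); rewrite E eqxx.
Qed.

Lemma tail_sink (e : edge G) : edge_tail e != sink G.
Proof.
apply/negP; rewrite tailE => /label_face E.
by have := label_sink lab (val e); rewrite E eqxx.
Qed.

Lemma notin_vertex f : ((inr false, true) \notin val f) /\ ((inr true, false) \notin val f).
Proof.
have /andP[_ nf] := valP f; rewrite !mem_vertex !(eq_sym _ (val f)).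
split=> //; apply: contra nf => /eqP ->.
by rewrite /unbounded_face eq_sym face_of_eq -/(unbounded_face D) unbounded_faceE !inE eqxx orbT.
Qed.

(** Ranks increase along dual edges, which excludes cycles. The boundary of a face contains a
    downward dart; if no dual edge enters the face, that dart belongs to the left frame edge and the
    face is the source. Upward darts give the sink. *)
Lemma truncated_dual_flow_network : flow_network G.
Proof.
(* The darts of a face share one label, so this maximum is its rank. *)
pose r f := (\max_(x in val f) rk (lab x))%N.
have rE f x : x \in val f -> r f = rk (lab x).
  move=> xf; apply/eqP; rewrite eqn_leq; apply/andP; split.
    by apply/bigmax_leqP => y yf; rewrite (label_vertex yf xf).
  by rewrite /r (bigD1 x) //= leq_maxl.
have radj f g : adjacent f g -> (r f < r g)%N.
  case/existsP => e /andP[]; rewrite tailE headE => /rE -> /rE ->.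
  exact: label_rank_lt.
split.
- move=> u v uv; apply/negP => /connectP[s]; have := radj _ _ uv.
  elim: s v {uv} => [|w s IH] v uv /=; first by move=> _ E; rewrite E ltnn in uv.
  by case/andP => /radj vw; apply: IH (ltn_trans uv vw).
- move=> f; split=> [nf|-> e]; last exact: head_source.
  have [x fx] := vertex_ex f; have [y] := face_down D x; rewrite -fx.
  have [n1 n2] := notin_vertex f.
  case: y => [[e|[]] []] //= yf _.
  + by have := nf (dual_of e); rewrite headE yf.
  + by rewrite yf in n2.
  + by apply/esym/eqP; rewrite sourceE.
move=> f; split=> [nf|-> e]; last exact: tail_sink.
have [x fx] := vertex_ex f; have [y] := face_up D x; rewrite -fx.
have [n1 n2] := notin_vertex f.
case: y => [[e|[]] []] //= yf _.
+ by have := nf (dual_of e); rewrite tailE yf.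
+ by apply/esym/eqP; rewrite sinkE.
+ by rewrite yf in n1.
Qed.

Implicit Types (fl : {ffun edge G -> R^o}).

(** An upward dart has the tail of the dual edge on its left and counts as outflow. The frame edges
    carry one unit, out of the sink and into the source, so that source and sink obey the same
    balance as the other faces. *)
Definition dart_flow fl x : R :=
  let c : R := if x.1 is inl e then fl (dual_of e) else 1 in
  if x.2 then c else - c.

Lemma sum_dart_flow fl f : \sum_(x in val f) dart_flow fl x =
  \sum_(e | edge_tail e == f) (fl e : R) - \sum_(e | edge_head e == f) (fl e : R)
  + (sink G == f)%:R - (source G == f)%:R.
Proof.
have [n1 n2] := notin_vertex f.
have S (Q : pred (hasse_edge P)) : \sum_(e | Q e) (fl (dual_of e) : R)
    = \sum_(e : edge G | Q (val e)) (fl e : R).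
  rewrite (reindex (val : edge G -> hasse_edge P)) /=; last first.
    by apply: onW_bij; exists dual_of => e; rewrite ?dual_of_val.
  by apply: eq_bigr => e _; rewrite dual_of_val.
pose F a b := if (a, b) \in val f then dart_flow fl (a, b) else 0.
have -> : \sum_(x in val f) dart_flow fl x = \sum_a \sum_b F a b.
  by rewrite pair_bigA big_mkcond; apply: eq_bigr => -[a b].
rewrite big_sumType big_bool !big_bool.
under eq_bigr do rewrite big_bool.
rewrite big_split.
have -> : \sum_e F (inl e) true = \sum_(e | edge_tail e == f) (fl e : R).
  rewrite -big_mkcond (S (fun e => (inl e, true) \in val f)).
  by apply: eq_bigl => e; rewrite tailE.
have -> : \sum_e F (inl e) false = - \sum_(e | edge_head e == f) (fl e : R).
  rewrite -big_mkcond sumrN (S (fun e => (inl e, false) \in val f)).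
  by congr (- _); apply: eq_bigl => e; rewrite headE.
rewrite /F (negbTE n1) (negbTE n2) -sinkE -sourceE /dart_flow.
by case: (sink G == f); case: (source G == f) => /=; ring.
Qed.

Lemma flow_polytopeP fl : flow_polytope R G fl <->
  (forall e : edge G, 0 <= (fl e : R)) /\ (forall f, \sum_(x in val f) dart_flow fl x = 0).
Proof.
have H0 : \sum_(e | edge_head e == source G) (fl e : R) = 0.
  by apply: big_pred0 => e; apply/negbTE/head_source.
have T0 : \sum_(e | edge_tail e == sink G) (fl e : R) = 0.
  by apply: big_pred0 => e; apply/negbTE/tail_sink.
have ss := source_neq_sink; have ss' := ss; rewrite eq_sym in ss'.
split=> [[fl0 so si inn]|[fl0 bal]]; split=> //.
- move=> f; rewrite sum_dart_flow.
  case: (eqVneq f (source G)) => [->|fso].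
    by rewrite so H0 (negbTE ss') ?eqxx /= ?mulr0n ?mulr1n; ring.
  case: (eqVneq f (sink G)) => [->|fsi].
    by rewrite si T0 ?(negbTE ss) ?eqxx /= ?mulr0n ?mulr1n; ring.
  by rewrite inn // /= ?mulr0n; ring.
- have := bal (source G); rewrite sum_dart_flow H0 (negbTE ss') eqxx.
  by move/eqP; rewrite subr0 addr0 subr_eq0 => /eqP.
- have := bal (sink G); rewrite sum_dart_flow T0 (negbTE ss) eqxx subr0.
  by move/eqP; rewrite sub0r addrC subr_eq0 => /eqP.
move=> f fso fsi; have := bal f; rewrite sum_dart_flow.
rewrite [sink G == f]eq_sym [source G == f]eq_sym (negbTE fso) (negbTE fsi).
by move/eqP; rewrite subr0 addr0 subr_eq0 => /eqP.
Qed.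

Implicit Types (u : {ffun P -> R^o}).

(** Linear part of [potential]; the constant 1 at [hat1] becomes the translation
    [gradient_shift]. *)
Definition potential0 u v : R := if v is inl p then u p else 0.
Definition potential u v : R := potential0 u v + (v == hat1 P)%:R.

Definition gradient0 u : {ffun edge G -> R^o} :=
  [ffun e => potential0 u (upper (val e)) - potential0 u (lower (val e))].

Definition gradient_shift : {ffun edge G -> R^o} :=
  [ffun e => (upper (val e) == hat1 P)%:R - (lower (val e) == hat1 P)%:R].

Fact gradient0_is_linear : linear gradient0.
Proof.
move=> a u w; apply/ffunP => e; rewrite !ffunE.
have E v : potential0 (a *: u + w) v = a * potential0 u v + potential0 w v.
  by case: v => [p|b]; rewrite /potential0 ?ffunE ?mulr0 ?addr0.
by rewrite !E /GRing.scale /=; ring.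
Qed.
HB.instance Definition _ := GRing.isLinear.Build R {ffun P -> R^o}
  {ffun edge G -> R^o} *:%R gradient0 gradient0_is_linear.

Lemma gradientE u (e : edge G) : (gradient0 u + gradient_shift) e
  = potential u (upper (val e)) - potential u (lower (val e)).
Proof. by rewrite !ffunE /potential; ring. Qed.

Lemma potential_hat0 u : potential u (hat0 P) = 0.
Proof. by rewrite /potential /= add0r. Qed.

Lemma potential_hat1 u : potential u (hat1 P) = 1.
Proof. by rewrite /potential /= add0r. Qed.

Lemma potential_inl u p : potential u (inl p) = u p.
Proof. by rewrite /potential /= addr0. Qed.

Lemma dart_flow_gradient u x : dart_flow (gradient0 u + gradient_shift) x
  = potential u (dart_end x) - potential u (dart_start x).
Proof.
case: x => [[e|b] []]; rewrite /dart_flow /dart_start /=;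
  rewrite ?gradientE ?potential_hat0 ?potential_hat1 /=; ring.
Qed.

Lemma hasse_monotone (X : hat P -> R) : (forall e, X (lower e) <= X (upper e)) ->
  forall v w, hat_lt v w -> X v <= X w.
Proof.
move=> mono v w; move: {2}(height w) (leqnn (height w)) => k.
elim: k w => [|k IH] w wk vw.
  by have := leq_trans (height_lt vw) wk.
have [z [zw vz]] := hat_lt_hasse vw.
have zwX : X z <= X w := mono (exist _ (z, w) zw).
case: vz => [<- //|vz]; apply: le_trans zwX; apply: IH => //.
by rewrite -ltnS (leq_trans _ wk) // height_lt; case/andP: zw.
Qed.

(** The bounds 0 and 1 are comparisons with [hat0] and [hat1], and monotonicity need only be tested
    on covering pairs. *)
Lemma order_polytopeP u : order_polytope R P u <->
  (forall e, potential u (lower e) <= potential u (upper e)).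
Proof.
split=> [[u01 umono] e|mono].
  have /andP[lt _] := valP e; move: lt; rewrite -/(lower e) -/(upper e).
  case: (lower e) (upper e) => [p|[]] [q|[]] //=;
    rewrite ?potential_inl ?potential_hat0 ?potential_hat1 ?ler01 //.
  - by move/ltW/umono.
  - by have /andP[] := u01 p.
  - by have /andP[] := u01 q.
have M := hasse_monotone mono; split=> [p|p q].
  have := M (hat0 P) (inl p) isT; have := M (inl p) (hat1 P) isT.
  by rewrite potential_inl potential_hat0 potential_hat1 => -> ->.
rewrite le_eqVlt => /orP[/eqP -> //|pq]; have := M (inl p) (inl q) pq.
by rewrite !potential_inl.
Qed.

(* [k] is fuel: [height v] steps reach the root of the tree. *)
Fixpoint tree_potential fl k v : R :=
  if k is k'.+1 then
    if [pick e | primary lab e && (upper e == v)] is Some e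
    then tree_potential fl k' (lower e) + fl (dual_of e) else 0
  else 0.

Lemma tree_potential_stable fl k k' v : (height v <= k)%N -> (height v <= k')%N ->
  tree_potential fl k v = tree_potential fl k' v.
Proof.
elim: k k' v => [|k IH] [|k'] v //=.
- case: pickP => // e /andP[_ /eqP <-] h.
  by have := hasse_height e; rewrite ltnNge (leq_trans h).
- case: pickP => // e /andP[_ /eqP <-] _ h.
  by have := hasse_height e; rewrite ltnNge (leq_trans h).
case: pickP => // e /andP[_ /eqP <-] h h'; have H := hasse_height e.
by rewrite (IH k') // -ltnS (leq_trans H).
Qed.

Lemma tree_potential_primary fl e : primary lab e ->
  tree_potential fl (height (upper e)) (upper e) =
  tree_potential fl (height (lower e)) (lower e) + fl (dual_of e).
Proof.
move=> pe; have := hasse_height e; case: (height (upper e)) => //= k h.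
case: pickP => [e' /andP[pe' /eqP E]|/(_ e)]; last by rewrite pe eqxx.
rewrite (primary_inj pe' pe E); congr (_ + _).
by apply: tree_potential_stable.
Qed.

Lemma flow_is_gradient fl : flow_polytope R G fl ->
  exists u, forall e, fl (dual_of e) = potential u (upper e) - potential u (lower e) :> R.
Proof.
case/flow_polytopeP => fl0 bal; pose X v := tree_potential fl (height v) v.
pose u : {ffun P -> R^o} := [ffun p => X (inl p)].
have X0 : X (hat0 P) = 0.
  rewrite /X; case: (height _) => //= k; case: pickP => // e /andP[_ /eqP E].
  by have := upper_neq_hat0 e; rewrite E eqxx.
have uX v : v != hat1 P -> potential u v = X v.
  case: v => [p|[]] // _; first by rewrite potential_inl ffunE.
  by rewrite potential_hat0.
(* Strong induction on the rank of the face to the left of [e]. *)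
exists u => e; move: {2}(rk (lab (inl e, true))).+1 (ltnSn (rk (lab (inl e, true)))) => k.
elim: k e => // k IH e ek; case pe: (primary lab e).
  by rewrite !uX ?(primary_hat1 pe) ?lower_neq_hat1 // /X tree_potential_primary // addrC addKr.
(* Along this face the other upward Hasse darts are primary, as [e] is the only non primary one; the
   edge of a downward dart has a face of smaller rank on its left, so the induction hypothesis
   applies; frame edges carry 1, the difference between [hat1] and [hat0]. *)
have E y : y \in face_of D (inl e, true) -> y != (inl e, true) ->
    dart_flow fl y = potential u (dart_end y) - potential u (dart_start y).
  move=> /label_face labE ne; case: y labE ne => [[e'|b] []] labE ne;
    rewrite /dart_flow /dart_start /= ?potential_hat0 ?potential_hat1; try by ring.
    case pe': (primary lab e').
      by rewrite !uX ?(primary_hat1 pe') ?lower_neq_hat1 // /X tree_potential_primary // addrC addKr.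
    by move: ne; rewrite (label_inj (negbT pe') (negbT pe) labE) eqxx.
  by rewrite IH ?opprB // (leq_trans (label_rank_lt lab e')) // labE.
(* The flow and the gradient both sum to 0 over this face and agree on all darts but [e], hence on
   [e]. *)
have := etrans (bal (edge_tail (dual_of e)))
  (esym (sum_face_potential D (potential u) (inl e, true))).
rewrite (bigD1 (inl e, true)) ?mem_face //= [in RHS](bigD1 (inl e, true)) ?mem_face //=.
rewrite (eq_bigr (fun y => potential u (dart_end y) - potential u (dart_start y))).
  by move/addIr.
by move=> y /andP[]; apply: E.
Qed.

Lemma order_flow : affine_equiv (order_polytope R P) (flow_polytope R G).
Proof.
exists (gradient0 : {linear {ffun P -> R^o} -> {ffun edge G -> R^o}}), gradient_shift.
split=> [u Ou|u w Ou Ow E|fl Ffl].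
- apply/flow_polytopeP; split=> [e|f].
    by rewrite gradientE subr_ge0; apply: (order_polytopeP u).1.
  have [x ->] := vertex_ex f; rewrite -[RHS](sum_face_potential D (potential u) x).
  by apply: eq_bigr => y _; apply: dart_flow_gradient.
- have {}E e : potential u (upper e) - potential u (lower e)
             = potential w (upper e) - potential w (lower e).
    by have /ffunP/(_ (dual_of e)) := E; rewrite !gradientE.
  (* Equal gradients propagate equality from [hat0] upward, through any down-edge. *)
  have {}E v : potential u v = potential w v.
    move: {2}(height v).+1 (ltnSn (height v)) => k; elim: k v => // k IH v vk.
    case: (eqVneq v (hat0 P)) => [->|v0]; first by rewrite !potential_hat0.
    have [e ev] := hasse_down v0; have := E e; rewrite (IH (lower e)).
      by rewrite ev => /addIr.
    by apply: (@leq_trans (height v)) => //; rewrite -ev hasse_height.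
  by apply/ffunP => p; rewrite -!potential_inl.
have [u uE] := flow_is_gradient Ffl; exists u; last first.
  by apply/ffunP => e; rewrite gradientE -uE dual_of_val.
apply/order_polytopeP => e; rewrite -subr_ge0 -uE.
by case: Ffl.
Qed.

End OrderFlow.

(** * Corners labelling the faces of the grid *)

Section Rows.
Context (n : nat) (lam : stair_partition n).
Local Open Scope nat_scope.
Implicit Types p q : skew_cell lam.

(** The cells of row [i] are in the columns strictly between [i] and [row_end i]; the row is
    nonempty when [i.+1 < row_end i]. *)
Definition row_end (i : nat) : nat := n - nth 0 lam i.

Lemma row_end_le i : row_end i <= n.
Proof. exact: leq_subr. Qed.

Lemma row_end_gt i : i < n -> i < row_end i.
Proof.
rewrite /row_end => iN; case: (ltnP i (size lam)) => isz.
  by have := parts_stair isz; lia.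
by rewrite nth_default // subn0.
Qed.

Lemma row_end_mono i j : i <= j -> row_end i <= row_end j.
Proof.
rewrite /row_end => ij; case: (ltnP j (size lam)) => jsz; last first.
  by rewrite [nth 0 lam j]nth_default // subn0 leq_subr.
apply: leq_sub2l; have := parts_sorted lam.
move/(sorted_leq_nth (rev_trans leq_trans) leqnn 0); apply; rewrite ?inE //.
exact: leq_ltn_trans jsz.
Qed.

Lemma cell_row_end p : cell_row p < cell_col p < row_end (cell_row p).
Proof.
have /andP[-> pn] := cell_bounds p; have := cell_notin p.
rewrite /in_diagram /row_end negb_and -!leqNgt -ltnNge => /orP[h|//].
by rewrite nth_default // subn0.
Qed.

Lemma cell_of i j : i < j < row_end i -> exists2 p : skew_cell lam, cell_row p = i & cell_col p = j.
Proof.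
case/andP => ij je; have jn := leq_trans je (row_end_le i); have iN := ltn_trans ij jn.
have H : (Ordinal iN < Ordinal jn) && ~~ in_diagram lam (Ordinal iN) (Ordinal jn).
  by rewrite /= ij; apply/negP => /andP[_]; rewrite leqNgt [_ < _]je.
by exists (exist _ (Ordinal iN, Ordinal jn) H).
Qed.

(* The first nonempty row reaching beyond column [j], or [n] if there is none. *)
Definition first_row (j : nat) : nat :=
  find (fun k => (j.+1 < row_end k) && (k.+1 < row_end k)) (iota 0 n).

Lemma first_row_le j : first_row j <= n.
Proof. by rewrite -[X in _ <= X](size_iota 0) find_size. Qed.

Lemma first_rowP j : first_row j < n ->
  (j.+1 < row_end (first_row j)) && ((first_row j).+1 < row_end (first_row j)).
Proof.
move=> h; have := h; rewrite /first_row -[X in _ < X](size_iota 0) -has_find.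
by move/(nth_find 0); rewrite nth_iota.
Qed.

Lemma first_row_min j k : k < first_row j -> row_end k <= maxn j k + 1.
Proof.
move=> h; have kn := leq_trans h (first_row_le j).
by have := before_find 0 h; rewrite nth_iota // add0n; lia.
Qed.

Lemma first_row_leq j k : j.+1 < row_end k -> k.+1 < row_end k -> first_row j <= k.
Proof. by move=> h1 h2; rewrite leqNgt; apply/negP => /first_row_min; lia. Qed.

(* A face is labelled by its lowest corner: the face whose lowest vertex is a cell
   [(i, j)], or [hat0] if [i = j], gets the label [(i, j)]; the face under [hat1]
   to the left of the maximal cell of row [k] gets the corner of row [k] and of
   the column of the preceding maximal cell. The sink gets [(n, n)]. *)
Definition prev_col (k : nat) : nat := if k is k'.+1 then (row_end k').-1 else 0.

Definition top_corner (k : nat) : nat * nat := (k, maxn k (prev_col k)).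

(** For [i <= j], the test says that [(i-1, j+1)] is a cell, so that the face above [(i, j)] closes
    up there as a grid square; otherwise the face extends up to [hat1]. *)
Definition corner (i j : nat) : nat * nat :=
  if first_row j < i then (i, j) else top_corner (first_row j).

(** For an empty poset [top_corner n] would be the label [(n, n)] of the sink, hence the separate
    value. *)
Definition source_corner : nat * nat :=
  if first_row 0 == n then (0, 0) else top_corner (first_row 0).

(** The abscissa of the corner once the matrix is turned by 45 degrees. *)
Definition corner_rank (c : nat * nat) : nat := c.1 + c.2.

Lemma corner_lt i j : first_row j < i -> corner i j = (i, j).
Proof. by rewrite /corner => ->. Qed.

Lemma corner_ge i j : i <= first_row j -> corner i j = top_corner (first_row j).
Proof. by rewrite /corner ltnNge => ->. Qed.

Lemma top_corner_n : top_corner n = (n, n).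
Proof.
rewrite /top_corner; congr (_, _); apply/maxn_idPl.
suff H k : prev_col k <= n by apply: H.
by case: k => // k; rewrite /prev_col; have := row_end_le k; lia.
Qed.

(** The rows whose last cell is a maximal element, by [max_cellP]. *)
Definition top_row k := (k.+1 < row_end k) && ((k == 0) || (row_end k.-1 < row_end k)).

Lemma first_row_top j : first_row j < n -> top_row (first_row j).
Proof.
move=> h; have /andP[h1 h2] := first_rowP h; rewrite /top_row h2 /=.
by case E: (first_row j) => [|k] //=; have := @first_row_min j k; rewrite E in h1 h2 *; lia.
Qed.

Lemma top_row_first k : top_row k -> first_row (row_end k).-2 = k.
Proof.
case/andP => h1 h2; apply/eqP; rewrite eqn_leq first_row_leq //=; last lia.
rewrite leqNgt; apply/negP => h.
have kn : k < n by have := row_end_le k; lia.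
have /andP[a b] := first_rowP (ltn_trans h kn).
by have := @row_end_mono (first_row (row_end k).-2) k.-1; lia.
Qed.

Lemma bottom_row_first k : k.+1 < row_end k -> (forall i, i < k -> row_end i <= k.+1) ->
  first_row k = k.
Proof.
move=> h1 h2; apply/eqP; rewrite eqn_leq first_row_leq //= leqNgt; apply/negP => h.
have kn : k < n by have := row_end_le k; lia.
by have /andP[a b] := first_rowP (ltn_trans h kn); have := h2 _ h; lia.
Qed.

(** * Increase of the rank across each kind of edge *)

Lemma corner_bottom_rank i : i.+1 < row_end i ->
  corner_rank (corner i i) < corner_rank (corner i.+1 i.+1).
Proof.
move=> h; apply: (@leq_ltn_trans (i + i)).
  rewrite /corner; case: (ltnP (first_row _)) => H; first by rewrite /corner_rank /=; lia.
  have -> : first_row i = i by apply/eqP; rewrite eqn_leq H first_row_leq.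
  rewrite /corner_rank /=; case: i H {h} => [|i] H //=.
  by have := first_row_min H; lia.
by rewrite /corner; case: (ltnP (first_row _)) => H; rewrite /corner_rank /=; lia.
Qed.

Lemma corner_right_rank i j : i < j -> j.+1 < row_end i ->
  corner_rank (corner i j) < corner_rank (corner i.+1 j).
Proof.
move=> ij h; have K : first_row j <= i by apply: first_row_leq; lia.
rewrite [corner i.+1 j]corner_lt //.
rewrite /corner; case: (ltnP (first_row _)) => H; first by rewrite /corner_rank /=; lia.
have -> : first_row j = i by apply/eqP; rewrite eqn_leq H K.
rewrite /corner_rank /=; case: i H {K} ij h => [|i] H ij h /=; first lia.
by have := first_row_min H; lia.
Qed.

Lemma corner_up_left i j : i.+1 < j -> j < row_end i -> corner i.+1 j.-1 = (i.+1, j.-1).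
Proof. by move=> ij h; rewrite corner_lt // ltnS first_row_leq; lia. Qed.

Lemma corner_up_rank i j : i.+1 < j -> j < row_end i ->
  corner_rank (corner i.+1 j.-1) < corner_rank (corner i.+1 j).
Proof.
move=> ij h; rewrite corner_up_left // /corner; case: (ltnP (first_row _)) => H.
  by rewrite /corner_rank /=; lia.
rewrite /corner_rank /=; case: (first_row j) H => // k H /=.
by have := @row_end_mono i k H; lia.
Qed.

Lemma corner_top_left i : top_row i -> corner i (row_end i).-2 = top_corner i.
Proof. by move=> /top_row_first h; rewrite corner_ge h. Qed.

Lemma first_row_end i : i < n -> i < first_row (row_end i).-1.
Proof.
move=> iN; rewrite ltnNge; apply/negP => h.
by have /andP[a b] := first_rowP (leq_ltn_trans h iN); have := row_end_mono h; lia.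
Qed.

Lemma corner_top_rank i : i < n -> top_row i ->
  corner_rank (corner i (row_end i).-2) < corner_rank (corner i.+1 (row_end i).-1).
Proof.
move=> iN t; have H := first_row_end iN; rewrite corner_top_left // corner_ge //.
case/andP: t => t1 t2; rewrite /corner_rank /=; case: (first_row _) H => // k H.
have := @row_end_mono i k H; case: i iN t1 t2 H => [|i] iN t1 /= t2 H; lia.
Qed.

(** With no cell just above [(i, j)], the two squares that would share that cell lie in one face
    under [hat1]. *)
Lemma corner_left_boundary i j : i < j -> j.+1 < row_end i ->
  ((i == 0) || (row_end i.-1 <= j)) -> corner i j = corner i j.-1.
Proof.
move=> ij h1 h2; have iN : i < n by have := row_end_le i; lia.
suff H l : j.-1 <= l <= j -> first_row l = i by rewrite !corner_ge !H //; lia.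
move=> lj; apply/eqP; rewrite eqn_leq first_row_leq //=; try lia.
rewrite leqNgt; apply/negP => h; have /andP[a b] := first_rowP (ltn_trans h iN).
by have := @row_end_mono (first_row l) i.-1; lia.
Qed.

(** Likewise for the two squares that would share the missing cell just after the end of row [i]. *)
Lemma corner_right_boundary i : i < n ->
  corner i (row_end i).-1 = corner i.+1 (row_end i).-1.
Proof. by move=> /first_row_end h; rewrite !corner_ge // ltnW. Qed.

(** If [k] is not [i.+1], the empty rows in between open a face reaching from [hat0] to [hat1], and
    both sides reduce to [top_corner k]. *)
Lemma corner_bottom_next i k : i < k -> i.+1 < row_end i -> k.+1 < row_end k ->
  (forall l, i < l < k -> row_end l <= l.+1) -> corner i.+1 i.+1 = corner k k.
Proof.
move=> ik hi hk hl; have kn : k < n by have := row_end_le k; lia.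
have [->//|ki] := eqVneq k i.+1.
have Hi := hl i.+1; have Hk := hl k.-1.
have F : first_row i.+1 = k.
  apply/eqP; rewrite eqn_leq first_row_leq //=; last lia.
  rewrite leqNgt; apply/negP => h; have /andP[a b] := first_rowP (ltn_trans h kn).
  have := hl (first_row i.+1); have := @row_end_mono (first_row i.+1) i.+1; lia.
have F' : first_row k = k.
  apply: bottom_row_first => // l lk; have := @row_end_mono l k.-1; lia.
by rewrite !corner_ge ?F ?F' //; lia.
Qed.

Lemma corner_bottom_first i : i.+1 < row_end i ->
  (forall l, l < i -> row_end l <= l.+1) -> source_corner = corner i i.
Proof.
move=> hi hl; have iN : i < n by have := row_end_le i; lia.
have F : first_row 0 = i.
  apply/eqP; rewrite eqn_leq first_row_leq //=; last lia.
  rewrite leqNgt; apply/negP => h; have /andP[a b] := first_rowP (ltn_trans h iN).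
  have := hl _ h; lia.
have F' : first_row i = i.
  by apply: bottom_row_first => // l li; have := hl l li; lia.
by rewrite corner_ge F' // /source_corner F ltn_eqF.
Qed.

Lemma corner_bottom_last i : i < n ->
  (forall l, l < n -> i < l -> row_end l <= l.+1) -> corner i.+1 i.+1 = (n, n).
Proof.
move=> iN hl; have F : first_row i.+1 = n.
  apply/eqP; rewrite eqn_leq first_row_le leqNgt /=; apply/negP => h.
  have /andP[a b] := first_rowP h; have := hl _ h; have := hl i.+1.
  have := row_end_le (first_row i.+1).
  have := @row_end_mono (first_row i.+1) i.+1; lia.
by rewrite corner_ge F ?top_corner_n.
Qed.

(** The first nonempty row reaching beyond row [i] is itself a top row, hence the next one, [k]. *)
Lemma corner_top_next i k : i < k -> k < n -> top_row k ->
  (forall l, i < l < k -> ~~ top_row l) ->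
  corner i.+1 (row_end i).-1 = corner k (row_end k).-2.
Proof.
move=> ik kn tk hl; have iN := ltn_trans ik kn; have H := first_row_end iN.
rewrite corner_top_left // corner_ge //; congr top_corner.
have K : first_row (row_end i).-1 <= k.
  have /andP[t1 t2] := tk; have := @row_end_mono i k.-1; have := row_end_gt iN.
  by move=> ? ?; apply: first_row_leq; lia.
apply/eqP; rewrite eqn_leq K leqNgt; apply/negP => h.
by have := first_row_top (ltn_trans h kn); apply/negP/hl; rewrite H.
Qed.

Lemma corner_top_first i : i < n -> top_row i -> (forall l, l < i -> ~~ top_row l) ->
  source_corner = corner i (row_end i).-2.
Proof.
move=> iN ti hl; rewrite corner_top_left //.
have F : first_row 0 = i.
  have K : first_row 0 <= i by case/andP: ti => ? ?; apply: first_row_leq; lia.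
  apply/eqP; rewrite eqn_leq K leqNgt; apply/negP => h.
  by have := first_row_top (ltn_trans h iN); apply/negP/hl.
by rewrite /source_corner F ltn_eqF.
Qed.

Lemma corner_top_last i : i < n -> (forall l, l < n -> i < l -> ~~ top_row l) ->
  corner i.+1 (row_end i).-1 = (n, n).
Proof.
move=> iN hl; have H := first_row_end iN; rewrite corner_ge //.
suff -> : first_row (row_end i).-1 = n by rewrite top_corner_n.
apply/eqP; rewrite eqn_leq first_row_le leqNgt; apply/negP => h.
by have := first_row_top h; apply/negP/hl.
Qed.

(** Labels of squares and of faces under [hat1] never collide: the column of [top_corner i] is at
    least that of the last cell of row [i-1], which lies beyond [j] when [first_row j < i]. *)
Lemma corner_neq_top i j k : i <= n -> first_row j < i -> top_corner k != (i, j).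
Proof.
move=> iN h; apply/eqP => -[E]; subst i; case: k iN h => // k kn h /= E.
have /andP[a b] := first_rowP (leq_trans h kn).
by have := @row_end_mono (first_row j) k; lia.
Qed.

Lemma corner_neq_source i j : i.+1 < row_end i -> corner i.+1 j != source_corner.
Proof.
move=> h; have iN : i < n by have := row_end_le i; lia.
have K : first_row 0 <= i by apply: first_row_leq; lia.
rewrite /source_corner ltn_eqF ?(leq_ltn_trans K) //.
rewrite /corner; case: (ltnP (first_row _)) => H; first by rewrite eq_sym corner_neq_top.
by apply/eqP => -[E _]; lia.
Qed.

Lemma corner_neq_sink i j : i.+1 < row_end i -> j.+1 < row_end i ->
  corner i j != (n, n).
Proof.
move=> h1 h2; have iN : i < n by have := row_end_le i; lia.
have K : first_row j <= i by apply: first_row_leq; lia.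
by rewrite /corner; case: ifP => _; apply/eqP => -[E _]; lia.
Qed.

Lemma source_corner_neq_sink : 0 < n -> source_corner != (n, n).
Proof.
move=> n0; rewrite /source_corner; case: (eqVneq (first_row 0)) => h; apply/eqP => -[E _]; first lia.
by rewrite E eqxx in h.
Qed.

End Rows.

(** * Faces of the grid embedding *)

Section SortedSequences.
Local Open Scope nat_scope.
Context (T : eqType) (le : rel T) (le_refl : reflexive le) (le_trans : transitive le).
Implicit Types (s : seq T) (x y z : T).

(** No element lies strictly between neighbours of a sorted sequence. This allows reasoning on edges
    sorted by drift without computing the sorted list. *)
Lemma sorted_consecutive (r : rel T) s : uniq s -> sorted le s ->
  (forall x y, x \in s -> y \in s -> x != y -> le x y ->
     (forall z, z \in s -> le z x \/ le y z) -> r x y) ->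
  sorted r s.
Proof.
case: s => // x0 s; set t := x0 :: s => ut st H; apply/(sortedP x0) => i it.
have lei := sorted_leq_nth le_trans le_refl x0 st.
have it' := ltnW it; apply: H; rewrite ?mem_nth ?nth_uniq ?ltn_eqF ?lei //.
move=> z /(nthP x0)[k kt <-]; case: (leqP k i) => ki; [left|right]; exact: lei.
Qed.

Lemma sorted_head x s z : sorted le (x :: s) -> z \in x :: s -> le x z.
Proof.
move=> st; rewrite inE => /orP[/eqP -> //|zs].
by have /allP := order_path_min le_trans st; apply.
Qed.

Lemma sorted_last x s z : sorted le (x :: s) -> z \in x :: s -> le z (last x s).
Proof.
move=> st zs; have := sorted_leq_nth le_trans le_refl x st (index z (x :: s)) (size s).
rewrite nth_index // nth_last; apply; rewrite ?inE ?index_mem //.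
by rewrite -ltnS -[(size s).+1]/(size (x :: s)) index_mem.
Qed.

End SortedSequences.

(** Shape of the edge list at [hat0] and [hat1], the frame edges being first and last. *)
Lemma cycle_frame (T : Type) (r : rel T) x y a s :
  r x a -> sorted r (a :: s) -> r (last a s) y -> r y x ->
  cycle r (x :: rcons (a :: s) y).
Proof. by move=> xa /= as_ sy yx; rewrite !rcons_path last_rcons xa as_ sy yx. Qed.

(** Shape of [clockwise] at a poset element: up-edges from left to right, then down-edges from right
    to left. *)
Lemma cycle_cat_rev (T : Type) (r : rel T) a s b t :
  sorted r (a :: s) -> sorted (fun x y => r y x) (b :: t) ->
  r (last a s) (last b t) -> r b a -> cycle r ((a :: s) ++ rev (b :: t)).
Proof.
move=> /= as_; rewrite -[path _ b t]/(sorted _ (b :: t)) -rev_sorted => bt lab ba.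
rewrite /= rcons_path cat_path last_cat as_ rev_cons last_rcons ba andbT /=.
case/lastP: t lab bt => [|t c]; first by rewrite /= => ->.
by rewrite last_rcons rev_cons rev_rcons /= => -> ->.
Qed.

Section GridLabelling.
Context (R : realFieldType) (n : nat) (lam : stair_partition n).
Let P := skew_cell lam.
Local Notation D := (grid_embedding R lam).
Implicit Types (p q : P) (e : hasse_edge P).
Local Notation row_end := (row_end lam).
Local Notation corner := (corner lam).
Local Notation top_row := (top_row lam).

(** Between two cells the edge is a step right within a row or a step up within a column. An edge
    from [hat0] to [hat1] occurs only for an empty poset. *)
Definition edge_left (v w : hat P) : nat * nat :=
  match v, w with
  | inl p, inl q => corner (cell_row p)
      (if cell_row p == cell_row q then cell_col p else (cell_col p).-1)
  | inl p, inr _ => corner (cell_row p) (cell_col p).-1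
  | inr _, inl p => corner (cell_row p) (cell_row p)
  | inr _, inr _ => (0, 0)%N
  end.

Definition edge_right (v w : hat P) : nat * nat :=
  match v, w with
  | inl p, inl q => corner (if cell_row p == cell_row q then (cell_row p).+1
                            else cell_row p) (cell_col p)
  | inl p, inr _ => corner (cell_row p).+1 (cell_col p)
  | inr _, inl p => corner (cell_row p).+1 (cell_row p).+1
  | inr _, inr _ => (n, n)
  end.

Definition grid_label (x : dart P) : nat * nat :=
  match x with
  | (inl e, true) => edge_left (lower e) (upper e)
  | (inl e, false) => edge_right (lower e) (upper e)
  | (inr false, false) => source_corner lam
  | (inr true, true) => (n, n)
  | _ => (n.+1, n.+1)
  end.

Local Notation left_label e := (grid_label (inl e, true)).
Local Notation right_label e := (grid_label (inl e, false)).

(** A cell is maximal exactly when it has neither a right nor an upper neighbour. *)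
Lemma max_cellP p : (forall q, ~~ (p < q)%O) <->
  top_row (cell_row p) /\ cell_col p = (row_end (cell_row p)).-1.
Proof.
have /andP[p1 p2] := cell_row_end p; split=> [pmax|[/andP[t1 t2] pc] q].
  have R1 : (row_end (cell_row p) <= (cell_col p).+1)%N.
    rewrite leqNgt; apply/negP => h.
    have [|q q1 q2] := @cell_of _ lam (cell_row p) (cell_col p).+1; first by lia.
    by have /negP[] := pmax q; apply/cell_ltP; split; [lia|lia|right; lia].
  have R2 : (cell_row p == 0)%N || (row_end (cell_row p).-1 <= cell_col p)%N.
    case E: (cell_row p) => [|i] //=; rewrite leqNgt; apply/negP => h.
    have [|q q1 q2] := @cell_of _ lam i (cell_col p); first by lia.
    by have /negP[] := pmax q; apply/cell_ltP; split; [lia|lia|left; lia].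
  by split; [apply/andP; split|]; lia.
apply/negP => /cell_ltP[a b c]; have /andP[q1 q2] := cell_row_end q.
have := @row_end_mono _ lam (cell_row q) (cell_row p) a.
have := @row_end_mono _ lam (cell_row q) (cell_row p).-1; lia.
Qed.

Variant edge_spec e : Prop :=
  | EdgeBottom p of lower e = hat0 P & upper e = inl p
      & cell_col p = (cell_row p).+1
  | EdgeRight p q of lower e = inl p & upper e = inl q
      & cell_row q = cell_row p & cell_col q = (cell_col p).+1
  | EdgeUp p q of lower e = inl p & upper e = inl q
      & cell_row p = (cell_row q).+1 & cell_col q = cell_col p
  | EdgeTop p of lower e = inl p & upper e = hat1 P
      & top_row (cell_row p) & cell_col p = (row_end (cell_row p)).-1
  | EdgeEmpty of lower e = hat0 P & upper e = hat1 P & (P -> False).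

Lemma edgeP e : edge_spec e.
Proof.
have := grid_edgeP (valP e); rewrite -/(lower e) -/(upper e) => g.
move: (erefl (lower e)) (erefl (upper e)).
case: {1}(lower e) {1}(upper e) / g => [p h|p q h1 h2|p q h1 h2|p h|h] el eu.
- exact: EdgeBottom (esym el) (esym eu) h.
- exact: EdgeRight (esym el) (esym eu) h1 h2.
- exact: EdgeUp (esym el) (esym eu) h1 h2.
- by have [t c] := (max_cellP p).1 h; apply: EdgeTop (esym el) (esym eu) t c.
- exact: EdgeEmpty (esym el) (esym eu) h.
Qed.

Lemma hasse_adjacent p q : (cell_row q <= cell_row p)%N -> (cell_col p <= cell_col q)%N ->
  (cell_row p + cell_col q = (cell_row q + cell_col p).+1)%N ->
  hasse (inl p : hat P) (inl q).
Proof.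
move=> a b c; rewrite /hasse /=; apply/andP; split.
  by apply/cell_ltP; split=> //; lia.
apply/existsPn => -[z|[]] //=; rewrite ?andbF //; apply/negP => /andP[].
by move=> /cell_ltP[a1 a2 a3] /cell_ltP[b1 b2 b3]; lia.
Qed.

Lemma adjacent_edge p q : (cell_row q <= cell_row p)%N -> (cell_col p <= cell_col q)%N ->
  (cell_row p + cell_col q = (cell_row q + cell_col p).+1)%N ->
  exists2 e, lower e = inl p & upper e = inl q.
Proof. by move=> a b c; exists (exist _ (inl p, inl q) (hasse_adjacent a b c)). Qed.

Lemma bottom_edge i : (i.+1 < row_end i)%N ->
  exists e p, [/\ lower e = hat0 P, upper e = inl p & cell_row p = i].
Proof.
move=> h; have [|p pi pj] := @cell_of _ lam i i.+1; first by rewrite leqnn.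
have H : hasse (hat0 P) (inl p).
  rewrite /hasse /=; apply/existsPn => -[z|[]] //=; apply/negP => /cell_ltP[a b c].
  by have /andP[d f] := cell_bounds z; lia.
by exists (exist _ (hat0 P, inl p) H), p.
Qed.

Lemma top_edge i : top_row i ->
  exists e p, [/\ lower e = inl p, upper e = hat1 P & cell_row p = i].
Proof.
move=> t; have /andP[t1 t2] := t.
have [|p pi pj] := @cell_of _ lam i (row_end i).-1; first by lia.
have H : hasse (inl p) (hat1 P).
  rewrite /hasse /=; apply/existsPn => -[z|[]] //=; rewrite andbT.
  by apply/(max_cellP p): z; rewrite pi.
by exists (exist _ (inl p, hat1 P) H), p.
Qed.

Lemma right_edge p : ((cell_col p).+1 < row_end (cell_row p))%N ->
  exists e q, [/\ lower e = inl p, upper e = inl q & cell_row q = cell_row p].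
Proof.
move=> h; have /andP[p1 p2] := cell_row_end p.
have [|q q1 q2] := @cell_of _ lam (cell_row p) (cell_col p).+1; first by lia.
have [|||e e1 e2] := @adjacent_edge p q; try lia.
by exists e, q.
Qed.

Lemma up_edge p i : cell_row p = i.+1 -> (cell_col p < row_end i)%N ->
  exists e q, [/\ lower e = inl p, upper e = inl q & cell_row q = i].
Proof.
move=> pi h; have /andP[p1 p2] := cell_row_end p.
have [|q q1 q2] := @cell_of _ lam i (cell_col p); first by lia.
have [|||e e1 e2] := @adjacent_edge p q; try lia.
by exists e, q.
Qed.

Lemma down_right_edge q : ((cell_row q).+1 < cell_col q)%N ->
  exists e p, [/\ lower e = inl p, upper e = inl q & cell_row p = cell_row q].
Proof.
move=> h; have /andP[p1 p2] := cell_row_end q.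
have [|p q1 q2] := @cell_of _ lam (cell_row q) (cell_col q).-1; first by lia.
have [|||e e1 e2] := @adjacent_edge p q; try lia.
by exists e, p.
Qed.

Lemma down_up_edge q : ((cell_row q).+1 < cell_col q)%N ->
  exists e p, [/\ lower e = inl p, upper e = inl q & cell_row p = (cell_row q).+1].
Proof.
move=> h; have /andP[p1 p2] := cell_row_end q.
have := @row_end_mono _ lam (cell_row q) (cell_row q).+1 (leqnSn _) => m.
have [|p q1 q2] := @cell_of _ lam (cell_row q).+1 (cell_col q); first by lia.
have [|||e e1 e2] := @adjacent_edge p q; try lia.
by exists e, p.
Qed.

(** * Left-to-right order of the edges at a vertex *)

Let driftE e v w : lower e = v -> upper e = w ->
  drift D e = ((grid_pos R w).1 - (grid_pos R v).1) / ((grid_pos R w).2 - (grid_pos R v).2).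
Proof. by move=> <- <-. Qed.

Lemma drift_right e p q : lower e = inl p -> upper e = inl q ->
  cell_row q = cell_row p -> cell_col q = (cell_col p).+1 -> drift D e = 1.
Proof.
move=> l u r c; rewrite (driftE l u) /= r c !natrD -!natr1.
by rewrite [X in X / _](_ : _ = 1) ?[X in _ / X](_ : _ = 1) ?divr1 //; ring.
Qed.

Lemma drift_up e p q : lower e = inl p -> upper e = inl q ->
  cell_row p = (cell_row q).+1 -> cell_col q = cell_col p -> drift D e = -1.
Proof.
move=> l u r c; rewrite (driftE l u) /= r c !natrD -!natr1.
by rewrite [X in X / _](_ : _ = -1) ?[X in _ / X](_ : _ = 1) ?divr1 //; ring.
Qed.

(** The edge from [hat0] to the first cell of row [i] rises by 1 and has drift [2 i + 1 - n]. *)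
Lemma drift_bottom e e' p p' : lower e = hat0 P -> lower e' = hat0 P ->
  upper e = inl p -> upper e' = inl p' ->
  drift D e <= drift D e' -> (cell_row p <= cell_row p')%N.
Proof.
move=> l l' u u'.
have C f q : lower f = hat0 P -> upper f = inl q -> cell_col q = (cell_row q).+1.
  move=> lf uf; case: (edgeP f); rewrite lf uf // => q' _ [->] //.
rewrite (driftE l u) (driftE l' u') /= (C _ _ l u) (C _ _ l' u') !natrD -!natr1.
rewrite [X in _ / X <= _](_ : _ = 1); last by ring.
rewrite [X in _ <= _ / X](_ : _ = 1); last by ring.
by rewrite !divr1 -(ler_nat R); lra.
Qed.

(** Maximal cells are pairwise incomparable, so among them rows and columns increase together. *)
Lemma drift_top e e' p p' : upper e = hat1 P -> upper e' = hat1 P ->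
  lower e = inl p -> lower e' = inl p' ->
  drift D e' <= drift D e -> (cell_row p <= cell_row p')%N.
Proof.
move=> u u' l l'; apply: contraTT; rewrite -ltnNge => rlt; rewrite -ltNge.
have M f q : upper f = hat1 P -> lower f = inl q -> forall q', ~~ (q < q')%O.
  by move=> uf lf; case: (edgeP f); rewrite lf uf // => q' [->] _ ? ?; apply/max_cellP.
have clt : (cell_col p' < cell_col p)%N.
  rewrite ltnNge; apply/negP => h; have /negP[] := M _ _ u l p'.
  by apply/cell_ltP; split=> //; [exact: ltnW|left].
have pos1E : grid_pos R (hat1 P) = (n%:R, 2 * n%:R + 1).
  by rewrite /grid_pos natrD natrM.
rewrite (driftE l u) (driftE l' u') pos1E /= !natrD.
have := cell_bounds p; have := cell_bounds p'; move: rlt clt.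
move: (cell_row p) (cell_col p) (cell_row p') (cell_col p') => c d a b.
rewrite -!(ltr_nat R) => ac bd /andP[ab bn] /andP[cd dn].
have a0 : 0 <= a%:R :> R by rewrite ler0n.
have pos1 : 0 < 2 * n%:R + 1 - (d%:R - c%:R) :> R by lra.
have pos2 : 0 < 2 * n%:R + 1 - (b%:R - a%:R) :> R by lra.
have ab' : a%:R + 1 <= b%:R :> R by rewrite natr1 ler_nat -(ltr_nat R).
have dn' : d%:R + 1 <= n%:R :> R by rewrite natr1 ler_nat -(ltr_nat R).
rewrite ltr_pdivrMr // mulrAC ltr_pdivlMr //.
(* The two positive products add up to the cross-multiplied difference of the drifts. *)
have h1 : 0 < (c%:R - a%:R) * (2 * n%:R + 1 - (b%:R - a%:R) + (n%:R - a%:R - b%:R)) :> R.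
  by apply: mulr_gt0; lra.
have h2 : 0 < (d%:R - b%:R) * (2 * n%:R + 1 - (b%:R - a%:R) - (n%:R - a%:R - b%:R)) :> R.
  by apply: mulr_gt0; lra.
lra.
Qed.

Lemma label_bottom e p : lower e = hat0 P -> upper e = inl p ->
  left_label e = corner (cell_row p) (cell_row p) /\
  right_label e = corner (cell_row p).+1 (cell_row p).+1.
Proof. by rewrite /grid_label => -> ->. Qed.

Lemma label_right e p q : lower e = inl p -> upper e = inl q -> cell_row q = cell_row p ->
  left_label e = corner (cell_row p) (cell_col p) /\
  right_label e = corner (cell_row p).+1 (cell_col p).
Proof. by rewrite /grid_label => -> -> /= ->; rewrite eqxx. Qed.

Lemma label_up e p q : lower e = inl p -> upper e = inl q -> cell_row p = (cell_row q).+1 ->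
  left_label e = corner (cell_row p) (cell_col p).-1 /\
  right_label e = corner (cell_row p) (cell_col p).
Proof. by rewrite /grid_label => -> -> /= ->; rewrite gtn_eqF. Qed.

Lemma label_top e p : lower e = inl p -> upper e = hat1 P ->
  left_label e = corner (cell_row p) (cell_col p).-1 /\
  right_label e = corner (cell_row p).+1 (cell_col p).
Proof. by rewrite /grid_label => -> ->. Qed.

Lemma label_empty e : lower e = hat0 P -> upper e = hat1 P ->
  left_label e = (0, 0)%N /\ right_label e = (n, n).
Proof. by rewrite /grid_label => -> ->. Qed.

Lemma drift_Nright_up : (1 <= -1 :> R) = false.
Proof. by apply/negbTE; rewrite -ltNge; lra. Qed.

Definition chain : rel (hasse_edge P) := fun e e' => right_label e == left_label e'.

Definition up_hasse (v : hat P) : seq (hasse_edge P) :=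
  sort (fun e e' => drift D e <= drift D e') [seq e <- enum {: hasse_edge P} | lower e == v].

Definition down_hasse (v : hat P) : seq (hasse_edge P) :=
  sort (fun e e' => drift D e' <= drift D e) [seq e <- enum {: hasse_edge P} | upper e == v].

Lemma mem_up_hasse v e : (e \in up_hasse v) = (lower e == v).
Proof. by rewrite mem_sort mem_filter mem_enum andbT. Qed.

Lemma mem_down_hasse v e : (e \in down_hasse v) = (upper e == v).
Proof. by rewrite mem_sort mem_filter mem_enum andbT. Qed.

Let up_refl : reflexive (fun e e' => drift D e <= drift D e').
Proof. by move=> e; apply: lexx. Qed.
Let up_trans : transitive (fun e e' => drift D e <= drift D e').
Proof. by move=> e' e e''; apply: le_trans. Qed.
Let down_refl : reflexive (fun e e' => drift D e' <= drift D e).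
Proof. by move=> e; apply: lexx. Qed.
Let down_trans : transitive (fun e e' => drift D e' <= drift D e).
Proof. by move=> e' e e'' h1 h2; apply: le_trans h2 h1. Qed.

Lemma up_hasse_sorted v : sorted (fun e e' => drift D e <= drift D e') (up_hasse v).
Proof. by apply: sort_sorted => e e'; apply: le_total. Qed.

Lemma down_hasse_sorted v : sorted (fun e e' => drift D e' <= drift D e) (down_hasse v).
Proof. by apply: sort_sorted => e e'; apply: le_total. Qed.

Lemma edge_neq e e' : e != e' -> lower e = lower e' -> upper e = upper e' -> False.
Proof. by move=> /eqP ne l u; apply: ne; apply: hasse_edge_inj. Qed.

(** At [hat0], neighbouring edges lead to consecutive nonempty rows; at a cell, the only possible
    pair is the step up followed by the step right. *)
Lemma up_hasse_chain v : sorted chain (up_hasse v).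
Proof.
apply: (sorted_consecutive up_refl up_trans); rewrite ?up_hasse_sorted //.
  by rewrite sort_uniq filter_uniq // enum_uniq.
move=> x y; rewrite !mem_up_hasse => /eqP lx /eqP ly ne xy between; subst v.
apply/eqP; have N := edge_neq ne (esym ly).
have {}between z : lower z = lower x -> drift D z <= drift D x \/ drift D y <= drift D z.
  by move=> h; apply: between; rewrite mem_up_hasse h.
case: (edgeP x) => [p lx ux cp|p q lx ux rq cq|p q lx ux rq cq|p lx ux tp cp|lx ux nP];
case: (edgeP y) => [p' ly' uy cp'|p' q' ly' uy rq' cq'|p' q' ly' uy rq' cq'|p' ly' uy tp' cp'|ly' uy nP'];
move: (ly); rewrite lx ly' // => E; try (case: E => E; subst p'); try (by case: (nP p')); try (by case: (nP' p));
try (have /andP[a1 a2] := cell_row_end p); try (have /andP[b1 b2] := cell_row_end q);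
try (have /andP[b1' b2'] := cell_row_end q').
- have [_ ->] := label_bottom lx ux; have [-> _] := label_bottom ly' uy.
  have rle := drift_bottom lx ly' ux uy xy.
  have rlt : (cell_row p < cell_row p')%N.
    rewrite ltn_neqAle rle andbT; apply/eqP => r; apply: N; rewrite ux uy; congr inl.
    by apply: skew_cell_inj; lia.
  have /andP[c1 c2] := cell_row_end p'.
  apply: corner_bottom_next => //; try lia.
  move=> l pl; rewrite leqNgt; apply/negP => /bottom_edge[z [r [lz uz rz]]].
  case: (between z); rewrite ?lz ?lx //.
    by move/(drift_bottom lz lx uz ux); lia.
  by move/(drift_bottom ly' lz uy uz); lia.
- by case: N; rewrite ux uy; congr inl; apply: skew_cell_inj; lia.
- move: xy; rewrite (drift_right lx ux rq cq) (drift_up ly' uy rq' cq').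
  by rewrite drift_Nright_up.
- by exfalso; rewrite rq in b2; lia.
- have [_ ->] := label_up lx ux rq; have [-> _] := label_right ly' uy rq'.
  by [].
- by case: N; rewrite ux uy; congr inl; apply: skew_cell_inj; lia.
- by exfalso; case/andP: tp' => t1 t2; rewrite rq /= in t2; rewrite rq in cp'; lia.
- by exfalso; rewrite rq' in b2'; lia.
- by exfalso; case/andP: tp => t1 t2; rewrite rq' /= in t2; rewrite rq' in cp; lia.
- by case: N; rewrite ux uy.
- by case: N; rewrite ux uy.
Qed.

(** At [hat1], neighbouring edges come from consecutive top rows; at a cell, the step right into it
    precedes the step up. *)
Lemma down_hasse_chain v : sorted chain (down_hasse v).
Proof.
apply: (sorted_consecutive down_refl down_trans); rewrite ?down_hasse_sorted //.
  by rewrite sort_uniq filter_uniq // enum_uniq.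
move=> x y; rewrite !mem_down_hasse => /eqP ux /eqP uy ne xy between; subst v.
apply/eqP; have N l := edge_neq ne l (esym uy).
have {}between z : upper z = upper x -> drift D x <= drift D z \/ drift D z <= drift D y.
  by move=> h; apply: between; rewrite mem_down_hasse h.
case: (edgeP x) => [q lx ux cp|p q lx ux rq cq|p q lx ux rq cq|p lx ux tp cp|lx ux nP];
case: (edgeP y) => [q' ly uy' cp'|p' q' ly uy' rq' cq'|p' q' ly uy' rq' cq'|p' ly uy' tp' cp'|ly uy' nP'];
move: (uy); rewrite ux uy' // => E; try (case: E => E; subst q'); try (by case: (nP p'));
try (by case: (nP' p));
try (have /andP[a1 a2] := cell_bounds p); try (have /andP[b1 b2] := cell_bounds p').
- by case: N; rewrite lx ly.
- by exfalso; lia.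
- by exfalso; lia.
- by exfalso; lia.
- by case: N; rewrite lx ly; congr inl; apply: skew_cell_inj; lia.
- have [_ ->] := label_right lx ux rq; have [-> _] := label_up ly uy' rq'.
  by rewrite rq' -cq' cq rq.
- by exfalso; lia.
- move: xy; rewrite (drift_up lx ux rq cq) (drift_right ly uy' rq' cq').
  by rewrite drift_Nright_up.
- by case: N; rewrite lx ly; congr inl; apply: skew_cell_inj; lia.
- have [_ ->] := label_top lx ux; have [-> _] := label_top ly uy'.
  have rle := drift_top ux uy' lx ly xy.
  have rlt : (cell_row p < cell_row p')%N.
    rewrite ltn_neqAle rle andbT; apply/eqP => r; apply: N; rewrite lx ly; congr inl.
    by apply: skew_cell_inj; rewrite ?cp ?cp' r.
  rewrite cp cp'; apply: corner_top_next => //; first by lia.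
  move=> l pl; apply/negP => /top_edge[z [r [lz uz rz]]].
  case: (between z); rewrite ?uz ?ux //.
    by move/(drift_top uz ux lz lx); lia.
  by move/(drift_top uy' uz ly lz); lia.
- by case: N; rewrite lx ly.
Qed.

(** This lemma and the next three show that the face to the left of a cell [(i, j)] is labelled
    [corner i j.-1] and the one to its right [corner i.+1 j], whether read from its up-edges or its
    down-edges. *)
Lemma up_leftmost e p : lower e = inl p ->
  (forall z, lower z = inl p -> drift D e <= drift D z) ->
  left_label e = corner (cell_row p) (cell_col p).-1.
Proof.
move=> le emin; case: (edgeP e) => [p' l|p' q l u r c|p' q l u r c|p' l u t c|l];
  move: (l); rewrite le // => -[?]; subst p'.
- have [-> _] := label_right l u r; have /andP[b1 b2] := cell_row_end q.
  have /andP[a1 a2] := cell_row_end p; rewrite r c in b2.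
  apply: corner_left_boundary => //; case E: (cell_row p) => [|i] //=.
  rewrite leqNgt; apply/negP => /(up_edge E)[z [q' [lz uz rz]]].
  have := emin z lz; rewrite (drift_right l u r c); case: (edgeP z); rewrite lz uz //.
    by move=> ? ? [<-] [<-]; rewrite E rz; lia.
  by move=> ? ? [<-] [<-] rr cc; rewrite (drift_up lz uz) // drift_Nright_up.
- by have [] := label_up l u r.
- by have [] := label_top l u.
Qed.

Lemma up_rightmost e p : lower e = inl p ->
  (forall z, lower z = inl p -> drift D z <= drift D e) ->
  right_label e = corner (cell_row p).+1 (cell_col p).
Proof.
move=> le emax; case: (edgeP e) => [p' l|p' q l u r c|p' q l u r c|p' l u t c|l];
  move: (l); rewrite le // => -[?]; subst p'.
- by have [] := label_right l u r.
- have [_ ->] := label_up l u r; have /andP[a1 a2] := cell_row_end p.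
  have /andP[b1 b2] := cell_bounds p.
  have h : cell_col p = (row_end (cell_row p)).-1.
    suff : (row_end (cell_row p) <= (cell_col p).+1)%N by lia.
    rewrite leqNgt; apply/negP => /right_edge[z [q' [lz uz rz]]].
    have := emax z lz; rewrite (drift_up l u r c); case: (edgeP z); rewrite lz uz //.
      by move=> ? ? [<-] [<-] rr cc; rewrite (drift_right lz uz) // drift_Nright_up.
    by move=> ? ? [<-] [<-]; rewrite rz; lia.
  by rewrite h; apply: corner_right_boundary; lia.
- by have [] := label_top l u.
Qed.

Lemma down_leftmost e q : upper e = inl q ->
  (forall z, upper z = inl q -> drift D z <= drift D e) ->
  left_label e = corner (cell_row q) (cell_col q).-1.
Proof.
move=> ue emax; case: (edgeP e) => [q' l u c|p q' l u r c|p q' l u r c|p l u|l u];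
  move: (u); rewrite ue // => -[?]; subst q'.
- by have [-> _] := label_bottom l u; rewrite c.
- by have [-> _] := label_right l u r; rewrite c r.
- exfalso; have /andP[a1 a2] := cell_bounds p.
  have [|z [q' [lz uz rz]]] := @down_right_edge q; first by lia.
  have := emax z uz; rewrite (drift_up l u r c); case: (edgeP z); rewrite lz uz //.
    by move=> ? ? [<-] [<-] rr cc; rewrite (drift_right lz uz) // drift_Nright_up.
  by move=> ? ? [<-] [<-]; rewrite rz; lia.
Qed.

Lemma down_rightmost e q : upper e = inl q ->
  (forall z, upper z = inl q -> drift D e <= drift D z) ->
  right_label e = corner (cell_row q).+1 (cell_col q).
Proof.
move=> ue emin; case: (edgeP e) => [q' l u c|p q' l u r c|p q' l u r c|p l u|l u];
  move: (u); rewrite ue // => -[?]; subst q'.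
- by have [_ ->] := label_bottom l u; rewrite c.
- exfalso; have /andP[a1 a2] := cell_bounds p.
  have [|z [q' [lz uz rz]]] := @down_up_edge q; first by lia.
  have := emin z uz; rewrite (drift_right l u r c); case: (edgeP z); rewrite lz uz //.
    by move=> ? ? [<-] [<-]; rewrite rz; lia.
  by move=> ? ? [<-] [<-] rr cc; rewrite (drift_up lz uz) // drift_Nright_up.
- by have [_ ->] := label_up l u r; rewrite c r.
Qed.

Lemma source_corner_empty : (P -> False) -> source_corner lam = (0, 0)%N.
Proof.
move=> nP; rewrite /source_corner; case: eqVneq => // h; exfalso.
have h' : (first_row lam 0 < n)%N by rewrite ltn_neqAle h first_row_le.
have /andP[a b] := first_rowP h'.
have [|p _ _] := @cell_of _ lam (first_row lam 0) (first_row lam 0).+1; last by case: (nP p).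
by rewrite leqnn.
Qed.

Lemma bottom_leftmost e : lower e = hat0 P ->
  (forall z, lower z = hat0 P -> drift D e <= drift D z) ->
  left_label e = source_corner lam.
Proof.
move=> le emin; case: (edgeP e) => [p l u c|p q l|p q l|p l|l u nP];
  move: (l); rewrite le // => _.
- have [-> _] := label_bottom l u; have /andP[a1 a2] := cell_row_end p.
  symmetry; apply: corner_bottom_first; first by lia.
  move=> i ip; rewrite leqNgt; apply/negP => /bottom_edge[z [r [lz uz rz]]].
  by have := drift_bottom l lz u uz (emin z lz); lia.
- by have [-> _] := label_empty l u; rewrite source_corner_empty.
Qed.

Lemma bottom_rightmost e : lower e = hat0 P ->
  (forall z, lower z = hat0 P -> drift D z <= drift D e) ->
  right_label e = (n, n).
Proof.
move=> le emax; case: (edgeP e) => [p l u c|p q l|p q l|p l|l u nP];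
  move: (l); rewrite le // => _; last by have [] := label_empty l u.
have [_ ->] := label_bottom l u; have /andP[a1 a2] := cell_bounds p.
apply: corner_bottom_last; first by lia.
move=> i _ ip; rewrite leqNgt; apply/negP => /bottom_edge[z [r [lz uz rz]]].
by have := drift_bottom lz l uz u (emax z lz); lia.
Qed.

Lemma top_leftmost e : upper e = hat1 P ->
  (forall z, upper z = hat1 P -> drift D z <= drift D e) ->
  left_label e = source_corner lam.
Proof.
move=> ue emax; case: (edgeP e) => [p l u|p q l u|p q l u|p l u t c|l u nP];
  move: (u); rewrite ue // => _.
- have [-> _] := label_top l u; have /andP[a1 a2] := cell_bounds p.
  rewrite c; symmetry; apply: corner_top_first => //; first by lia.
  move=> i ip; apply/negP => /top_edge[z [r [lz uz rz]]].
  by have := drift_top u uz l lz (emax z uz); lia.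
- by have [-> _] := label_empty l u; rewrite source_corner_empty.
Qed.

Lemma top_rightmost e : upper e = hat1 P ->
  (forall z, upper z = hat1 P -> drift D e <= drift D z) ->
  right_label e = (n, n).
Proof.
move=> ue emin; case: (edgeP e) => [p l u|p q l u|p q l u|p l u t c|l u nP];
  move: (u); rewrite ue // => _; last by have [] := label_empty l u.
have [_ ->] := label_top l u; have /andP[a1 a2] := cell_bounds p.
rewrite c; apply: corner_top_last; first by lia.
move=> i _ ip; apply/negP => /top_edge[z [r [lz uz rz]]].
by have := drift_top uz u lz l (emin z uz); lia.
Qed.

Lemma up_hasse_cons v : v != hat1 P -> exists a s,
  [/\ up_hasse v = a :: s, lower a = v, lower (last a s) = v,
      forall z, lower z = v -> drift D a <= drift D z
    & forall z, lower z = v -> drift D z <= drift D (last a s)].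
Proof.
move=> /hasse_up[e ev]; have := up_hasse_sorted v.
have : e \in up_hasse v by rewrite mem_up_hasse ev.
have M z : (z \in up_hasse v) = (lower z == v) by apply: mem_up_hasse.
case: (up_hasse v) M => // a s M _ st; exists a, s; split=> //.
- by apply/eqP; rewrite -M mem_head.
- by apply/eqP; rewrite -M mem_last.
- by move=> z /eqP; rewrite -M; apply: (sorted_head up_refl up_trans st).
- by move=> z /eqP; rewrite -M; apply: (sorted_last up_refl up_trans st).
Qed.

Lemma down_hasse_cons v : v != hat0 P -> exists a s,
  [/\ down_hasse v = a :: s, upper a = v, upper (last a s) = v,
      forall z, upper z = v -> drift D z <= drift D a
    & forall z, upper z = v -> drift D (last a s) <= drift D z].
Proof.
move=> /hasse_down[e ev]; have := down_hasse_sorted v.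
have : e \in down_hasse v by rewrite mem_down_hasse ev.
have M z : (z \in down_hasse v) = (upper z == v) by apply: mem_down_hasse.
case: (down_hasse v) M => // a s M _ st; exists a, s; split=> //.
- by apply/eqP; rewrite -M mem_head.
- by apply/eqP; rewrite -M mem_last.
- by move=> z /eqP; rewrite -M; apply: (sorted_head down_refl down_trans st).
- by move=> z /eqP; rewrite -M; apply: (sorted_last down_refl down_trans st).
Qed.

(** Clockwise around a vertex, the face to the right of a dart is the one to the left of the next
    dart; this is the local form of invariance under [face_step]. *)
Lemma grid_label_cycle v :
  cycle (fun x y => grid_label (dart_rev x) == grid_label y) (clockwise D v).
Proof.
pose r (a b : hat_edge P) := grid_label (a, false) == grid_label (b, true).
have rinl s : sorted chain s -> sorted r [seq inl e | e <- s] by rewrite sorted_map.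
have frame s a t : s = a :: t -> sorted chain s -> left_label a = source_corner lam ->
    right_label (last a t) = (n, n) -> cycle r (enframe true s).
  move=> -> /rinl ch la ll; apply: cycle_frame => //; rewrite /r ?last_map.
  - by rewrite la.
  - by rewrite ll.
  - by [].
case: (eqVneq v (hat0 P)) => [->|v0].
  have [a [s [E la ls amin smax]]] := @up_hasse_cons (hat0 P) isT.
  rewrite /clockwise down_edges_hat0 cats0 cycle_map /up_edges eqxx -/(up_hasse _).
  by apply: (frame _ a s E (up_hasse_chain _)); [exact: bottom_leftmost|exact: bottom_rightmost].
case: (eqVneq v (hat1 P)) => [->|v1].
  have [a [s [E la ls amin smax]]] := @down_hasse_cons (hat1 P) isT.
  (* Reversing the list and exchanging the two sides of each edge gives the same cyclic condition as
     at [hat0]. *)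
  rewrite /clockwise up_edges_hat1 rev_cycle cycle_map /down_edges eqxx -/(down_hasse _).
  rewrite (eq_cycle (e' := r)); last by move=> x y; rewrite /r /= eq_sym.
  by apply: (frame _ a s E (down_hasse_chain _)); [exact: top_leftmost|exact: top_rightmost].
have [a [s [E la ls amin smax]]] := up_hasse_cons v1.
have [b [t [E' lb lt bmin tmax]]] := down_hasse_cons v0.
have := up_hasse_chain v; have := down_hasse_chain v.
rewrite /clockwise /up_edges /down_edges (negbTE v0) (negbTE v1) /enframe.
rewrite -/(up_hasse v) -/(down_hasse v) E E' => /rinl cht /rinl chs.
case: v v0 v1 la ls amin smax lb lt bmin tmax {E E'} => [p|[]] // _ _ la ls amin smax lb lt bmin tmax.
set rel := fun x y => _ == _.
have S1 : sorted rel [seq (x, true) | x <- [seq inl e | e <- a :: s]].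
  by rewrite sorted_map.
have S2 : sorted (fun x y => rel y x) [seq (x, false) | x <- [seq inl e | e <- b :: t]].
  by rewrite sorted_map (eq_sorted (e' := r)) // => x y; rewrite /r /rel /= eq_sym.
apply: (cycle_cat_rev S1 S2); rewrite ?last_map /rel [dart_rev _]/=.
  by rewrite (@up_rightmost (last a s) p) // (@down_rightmost (last b t) p).
by rewrite (@up_leftmost a p) // (@down_leftmost b p).
Qed.

Lemma grid_label_step x : grid_label (face_step D x) = grid_label x.
Proof.
have xin : dart_rev x \in clockwise D (dart_end x).
  by rewrite mem_clockwise /dart_start dart_revK.
have := next_cycle (grid_label_cycle (dart_end x)) xin.
by rewrite dart_revK => /eqP.
Qed.

(** The edges from [hat0] to cells and the steps right: each nonempty row becomes a path starting at
    [hat0]. *)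
Definition grid_primary e : bool :=
  match lower e, upper e with
  | inr _, inl _ => true
  | inl p, inl q => cell_row p == cell_row q
  | _, _ => false
  end.

Lemma grid_label_rank_lt e : (0 < n)%N ->
  (corner_rank (left_label e) < corner_rank (right_label e))%N.
Proof.
move=> n0; case: (edgeP e) => [p l u c|p q l u r c|p q l u r c|p l u t c|l u nP].
- have [-> ->] := label_bottom l u; have /andP[a b] := cell_row_end p.
  by apply: corner_bottom_rank; lia.
- have [-> ->] := label_right l u r; have /andP[a b] := cell_row_end p.
  have /andP[a' b'] := cell_row_end q; rewrite r c in b'.
  exact: corner_right_rank.
- have [-> ->] := label_up l u r; have /andP[a b] := cell_row_end p.
  have /andP[a' b'] := cell_row_end q; rewrite r in a b *; rewrite c in b'.
  exact: corner_up_rank.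
- have [-> ->] := label_top l u; have /andP[a b] := cell_bounds p; rewrite c.
  by apply: corner_top_rank => //; lia.
- by have [-> ->] := label_empty l u; rewrite /corner_rank /=; lia.
Qed.

Lemma right_label_neq_source e : (0 < n)%N -> right_label e != source_corner lam.
Proof.
move=> n0; case: (edgeP e) => [p l u c|p q l u r c|p q l u r c|p l u t c|l u nP].
- have [_ ->] := label_bottom l u; have /andP[a b] := cell_row_end p.
  by apply: corner_neq_source; lia.
- have [_ ->] := label_right l u r; have /andP[a b] := cell_row_end p.
  by apply: corner_neq_source; lia.
- have [_ ->] := label_up l u r; have /andP[a b] := cell_row_end q.
  by rewrite r; apply: corner_neq_source; lia.
- have [_ ->] := label_top l u; have /andP[a b] := cell_row_end p.
  by apply: corner_neq_source; lia.
- by have [_ ->] := label_empty l u; rewrite eq_sym source_corner_neq_sink.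
Qed.

Lemma left_label_neq_sink e : (0 < n)%N -> left_label e != (n, n).
Proof.
move=> n0; case: (edgeP e) => [p l u c|p q l u r c|p q l u r c|p l u t c|l u nP].
- have [-> _] := label_bottom l u; have /andP[a b] := cell_row_end p.
  by apply: corner_neq_sink; lia.
- have [-> _] := label_right l u r; have /andP[a b] := cell_row_end p.
  have /andP[a' b'] := cell_row_end q; rewrite r c in b'.
  by apply: corner_neq_sink; lia.
- have [-> _] := label_up l u r; have /andP[a b] := cell_row_end p.
  by apply: corner_neq_sink; lia.
- have [-> _] := label_top l u; have /andP[a b] := cell_row_end p.
  by apply: corner_neq_sink; lia.
- by have [-> _] := label_empty l u; apply/eqP => -[]; lia.
Qed.

Lemma grid_primary_ex p : exists2 e, grid_primary e & upper e = inl p.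
Proof.
have /andP[a b] := cell_row_end p.
case: (ltnP (cell_row p).+1 (cell_col p)) => h.
  have [e [q [l u r]]] := down_right_edge h.
  by exists e => //; rewrite /grid_primary l u r eqxx.
have [|e [q [l u r]]] := @bottom_edge (cell_row p); first by lia.
exists e; first by rewrite /grid_primary l u.
rewrite u; congr inl; apply: skew_cell_inj => //.
case: (edgeP e); rewrite l // => q' _; rewrite u => -[<-]; lia.
Qed.

Lemma grid_primary_inj : {in grid_primary &, injective (@upper _ P)}.
Proof.
move=> e e'; rewrite !unfold_in /grid_primary => pe pe' ue.
apply: hasse_edge_inj (ue); move: pe pe'.
case: (edgeP e) => [p l u c|p q l u r c|p q l u r c|p l u t c|l u nP];
case: (edgeP e') => [p' l' u' c'|p' q' l' u' r' c'|p' q' l' u' r' c'|p' l' u' t' c'|l' u' nP'];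
  rewrite l u l' u' //; move: (ue); rewrite u u' => -[] E; try subst p'; try subst q';
  try (have := cell_bounds p); try (have := cell_bounds p'); try lia.
by move=> _ _ _ _; congr inl; apply: skew_cell_inj; lia.
Qed.

Lemma grid_primary_hat1 e : grid_primary e -> upper e != hat1 P.
Proof. by rewrite /grid_primary; case: (lower e) (upper e) => [p|b] [q|b']. Qed.

(** Apart from the single edge of an empty poset, non primary edges are steps up, whose left label
    is a square corner determining the cell, and edges to [hat1], whose left label is a top corner
    determining the row. *)
Lemma grid_label_inj e e' : ~~ grid_primary e -> ~~ grid_primary e' ->
  left_label e = left_label e' -> e = e'.
Proof.
have U f p q : lower f = inl p -> upper f = inl q -> cell_row p = (cell_row q).+1 ->
    cell_col q = cell_col p ->
    left_label f = (cell_row p, (cell_col p).-1) /\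
    (first_row lam (cell_col p).-1 < cell_row p <= n)%N.
  move=> l u r c; have /andP[a b] := cell_bounds p; have /andP[a1 b1] := cell_row_end q.
  have [-> _] := label_up l u r; rewrite r in a *; rewrite c in b1.
  rewrite corner_up_left //; split=> //; rewrite ltnS.
  by rewrite first_row_leq; lia.
have Tp f p : lower f = inl p -> upper f = hat1 P -> top_row (cell_row p) ->
    cell_col p = (row_end (cell_row p)).-1 -> left_label f = top_corner lam (cell_row p).
  by move=> l u t c; have [-> _] := label_top l u; rewrite c corner_top_left.
case: (edgeP e) => [p l u c|p q l u r c|p q l u r c|p l u t c|l u nP];
case: (edgeP e') => [p' l' u' c'|p' q' l' u' r' c'|p' q' l' u' r' c'|p' l' u' t' c'|l' u' nP'];
  rewrite /grid_primary l u l' u' ?r ?r' ?eqxx // => _ _;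
  try (by case: (nP p')); try (by case: (nP' p)).
- have [-> h] := U _ _ _ l u r c; have [-> h'] := U _ _ _ l' u' r' c'.
  have /andP[a b] := cell_bounds p; have /andP[a' b'] := cell_bounds p'.
  move=> [E1 E2]; apply: hasse_edge_inj; rewrite ?l ?l' ?u ?u'; congr inl;
    apply: skew_cell_inj; lia.
- have [-> /andP[h1 h2]] := U _ _ _ l u r c; rewrite (Tp _ _ l' u' t' c').
  by move/esym/eqP; rewrite (negbTE (corner_neq_top _ h2 h1)).
- have [-> /andP[h1 h2]] := U _ _ _ l' u' r' c'; rewrite (Tp _ _ l u t c).
  by move/eqP; rewrite (negbTE (corner_neq_top _ h2 h1)).
- rewrite (Tp _ _ l u t c) (Tp _ _ l' u' t' c') => -[E _].
  apply: hasse_edge_inj; rewrite ?l ?l' ?u ?u' //; congr inl.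
  by apply: skew_cell_inj; rewrite ?c ?c' E.
- by move=> _; apply: hasse_edge_inj; rewrite ?l ?l' ?u ?u'.
Qed.

Definition grid_labelling (n0 : (0 < n)%N) : face_labelling D (nat * nat)%type := {|
  label := grid_label;
  label_rank := corner_rank;
  primary := grid_primary;
  label_step := grid_label_step;
  label_rank_lt := fun e => grid_label_rank_lt e n0;
  label_source := fun e => right_label_neq_source e n0;
  label_sink := fun e => left_label_neq_sink e n0;
  label_source_sink := source_corner_neq_sink lam n0;
  primary_ex := grid_primary_ex;
  primary_inj := grid_primary_inj;
  primary_hat1 := grid_primary_hat1;
  label_inj := grid_label_inj
|}.

End GridLabelling.

Theorem theorem1p1 (R : realFieldType) (n : nat) (n_ge1 : (1 <= n)%N)
    (lam : stair_partition n) :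
  let G := truncated_dual (grid_embedding R lam) in
  [/\ affine_equiv (asm_face R lam) (order_polytope R (skew_cell lam)),
      flow_network G /\ affine_equiv (asm_face R lam) (flow_polytope R G),
      (exists (d : Order.disp_t) (Q : finPOrderType d),
         affine_equiv (asm_face R lam) (order_polytope R Q))
    & (exists H : network,
         flow_network H /\ affine_equiv (asm_face R lam) (flow_polytope R H))].
Proof.
move=> G; have lab := grid_labelling R lam n_ge1.
have AO := asm_face_order R lam.
have FG := conj (truncated_dual_flow_network lab) (affine_equiv_trans AO (order_flow lab)).
split=> //; last by exists G.
by exists _, (skew_cell lam).
Qed.
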